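(* Let $Q$ be an affine quiver of type $\widetilde{\mathbb A}_{p,q}$ ($p,q\ge1$), $\widetilde{\mathbb D}_n$ ($n\ge5$), $\widetilde{\mathbb E}_6$, $\widetilde{\mathbb E}_7$ or $\widetilde{\mathbb E}_8$ with the orientation listed in the context, and let $f_c$ be its Coxeter automorphism. Then each irreducible component of the frieze variety $X(Q,f_c,\mathbf 1)$ is smooth.
   Context: The quivers considered are the following (arrows listed). Type $\widetilde{\mathbb A}_{p,q}$, $p,q\ge1$: vertices $1,\dots,p+q$; a directed path $p+q\to q\to q-1\to\dots\to2\to1$ with $q$ arrows and a directed path $p+q\to p+q-1\to\dots\to q+1\to 1$ with $p$ arrows (if $q=1$, resp. $p=1$, the corresponding path is a single arrow $p+q\to1$). Type $\widetilde{\mathbb D}_n$, $n\ge5$ (here $n$ is the number of vertices): vertices $1,\dots,n$; arrows $3\to1$, $3\to2$, $n-2\to n-3\to\dots\to 3$, $n\to n-2$, $n-1\to n-2$. Type $\widetilde{\mathbb E}_6$: vertices $1,\dots,7$; arrows $7\to2\to1$, $7\to4\to3$, $7\to6\to5$. Type $\widetilde{\mathbb E}_7$: vertices $1,\dots,8$; arrows $8\to3\to2\to1$, $8\to6\to5\to4$, $8\to7$. Type $\widetilde{\mathbb E}_8$: vertices $1,\dots,9$; arrows $9\to5\to4\to3\to2\to1$, $9\to8\to7$, $9\to6$. In all cases an arrow $i\to j$ implies $i>j$. Let $N$ be the number of vertices of $Q$, let $\mathcal A(\mathbf x,Q)$ be the cluster algebra with initial seed $(\mathbf x=(x_1,\dots,x_N),Q)$,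 and $\mu_c=\mu_N\cdots\mu_1$ (mutate first at $1$). The Coxeter automorphism $f_c$ is the unique cluster automorphism with $f_c^t(\mathbf x)=\mu_c^t(\mathbf x)$ for all $t\ge0$. Explicitly, $f_c^t(\mathbf x)=(x_{1,t},\dots,x_{N,t})$ with $x_{i,0}=x_i$ and $x_{i,t+1}x_{i,t}=\prod_{j\to i}x_{j,t}\cdot\prod_{i\to k}x_{k,t+1}+1$. The frieze variety $X(Q,f_c,\mathbf 1)$ is the Zariski closure in $\mathbb C^N$ of the set of values $\{f_c^t(\mathbf x)|_{\mathbf x=(1,\dots,1)}:t\ge0\}$. *)

(* Defs.v *)
From HB Require Import structures.
From mathcomp Require Import all_boot all_order all_fingroup all_algebra.
From mathcomp Require Import boolp classical_sets reals.
From mathcomp Require Import complex.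
From mathcomp Require Import mpoly.

Set Implicit Arguments.
Unset Strict Implicit.
Unset Printing Implicit Defensive.

Import Order.TTheory GRing.Theory Num.Theory.
Local Open Scope ring_scope.

(** Points of K^N are row vectors, [x 0 i] being the i-th coordinate. *)

Definition zero_locus (K : fieldType) (N : nat) (I : set {mpoly K[N]}) :
  set 'rV[K]_N := [set x | forall p, I p -> p.@[x 0] = 0].

Definition vanishing_ideal (K : fieldType) (N : nat) (X : set 'rV[K]_N) :
  set {mpoly K[N]} := [set p | forall x, X x -> p.@[x 0] = 0].

Definition zariski_closed (K : fieldType) (N : nat) (X : set 'rV[K]_N) : Prop :=
  exists I : set {mpoly K[N]}, X = zero_locus I.

Definition zariski_closure (K : fieldType) (N : nat) (X : set 'rV[K]_N) :
  set 'rV[K]_N :=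
  [set x | forall Z, zariski_closed Z -> (X `<=` Z)%classic -> Z x].

Definition zariski_irreducible (K : fieldType) (N : nat) (Y : set 'rV[K]_N) :
  Prop :=
  (Y !=set0)%classic /\
  forall Z1 Z2, zariski_closed Z1 -> zariski_closed Z2 ->
    (Y `<=` Z1 `|` Z2 -> Y `<=` Z1 \/ Y `<=` Z2)%classic.

Definition irreducible_component (K : fieldType) (N : nat)
    (X Y : set 'rV[K]_N) : Prop :=
  [/\ zariski_irreducible Y, (Y `<=` X)%classic
    & forall Z, zariski_irreducible Z ->
        (Z `<=` X -> Y `<=` Z -> Z `<=` Y)%classic].

Definition irreducible_chain (K : fieldType) (N : nat) (Y : set 'rV[K]_N)
    (d : nat) (Z : nat -> set 'rV[K]_N) : Prop :=
  (forall k, (k <= d)%N ->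
     [/\ zariski_closed (Z k), zariski_irreducible (Z k)
       & (Z k `<=` Y)%classic]) /\
  (forall k, (k < d)%N -> (Z k `<` Z k.+1)%classic).

Definition krull_dim_is (K : fieldType) (N : nat) (Y : set 'rV[K]_N)
    (d : nat) : Prop :=
  (exists Z, irreducible_chain Y d Z) /\
  (forall d' Z, irreducible_chain Y d' Z -> (d' <= d)%N).

(** The Zariski tangent space at [a]: the kernel of the Jacobian of all the
    equations of [Y]. *)
Definition tangent_space (K : fieldType) (N : nat) (Y : set 'rV[K]_N)
    (a : 'rV[K]_N) : set 'rV[K]_N :=
  [set v | forall p, vanishing_ideal Y p ->
     \sum_(i < N) (p^`M(i)).@[a 0] * v 0 i = 0].

(** Smoothness of an irreducible variety (so that its dimension is the same at
    all of its points): dim T_a Y = dim Y for every point a of Y. *)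
Definition smooth_variety (K : fieldType) (N : nat) (Y : set 'rV[K]_N) : Prop :=
  exists2 d, krull_dim_is Y d &
    forall a, Y a -> exists2 U : {vspace 'rV[K]_N},
      (forall v, v \in U <-> tangent_space Y a v) & \dim U = d.

(** [Q i j] is the number of arrows i -> j; quivers are without loops or
    2-cycles, which mutation preserves. *)

Definition quiver (N : nat) := 'M[nat]_N.

(** Add an arrow i -> j for each path i -> k -> j, remove 2-cycles (this is the
    effect of the truncated subtraction), reverse the arrows at k. *)
Definition mutate_quiver (N : nat) (Q : quiver N) (k : 'I_N) : quiver N :=
  \matrix_(i, j)
    if (i == k) || (j == k) then Q j i
    else ((Q i j + Q i k * Q k j) - (Q j i + Q j k * Q k i))%N.

Definition ambient (N : nat) : fieldType := {fraction {mpoly rat[N]}}.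

Record seed (N : nat) := Seed {
  cluster : 'I_N -> ambient N;
  seed_quiver : quiver N }.

Definition initial_variable (N : nat) (i : 'I_N) : ambient N :=
  tofrac ('X_i : {mpoly rat[N]}).

Definition initial_seed (N : nat) (Q : quiver N) : seed N :=
  Seed (@initial_variable N) Q.

Definition mutate (N : nat) (S : seed N) (k : 'I_N) : seed N :=
  let x := cluster S in
  let Q := seed_quiver S in
  Seed (fun i => if i == k
                 then (\prod_(j < N) x j ^+ Q j k
                       + \prod_(j < N) x j ^+ Q k j) / x k
                 else x i)
       (mutate_quiver Q k).

(** mu_c = mu_N ... mu_1; [enum 'I_N] lists the vertices increasingly, and the
    head of the list is mutated first. *)
Definition mu_c (N : nat) (S : seed N) : seed N :=
  foldl (@mutate N) S (enum 'I_N).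

Definition is_seed (N : nat) (Q : quiver N) (S : seed N) : Prop :=
  exists ks : seq 'I_N, S = foldl (@mutate N) (initial_seed Q) ks.

(** The subring of the ambient field generated by all cluster variables. *)
Inductive cluster_algebra (N : nat) (Q : quiver N) : ambient N -> Prop :=
| cluster_algebra_var S i : is_seed Q S -> cluster_algebra Q (cluster S i)
| cluster_algebra1 : cluster_algebra Q 1
| cluster_algebraB g h : cluster_algebra Q g -> cluster_algebra Q h ->
    cluster_algebra Q (g - h)
| cluster_algebraM g h : cluster_algebra Q g -> cluster_algebra Q h ->
    cluster_algebra Q (g * h).

(** A ring automorphism of the cluster algebra extends uniquely to its fraction
    field, so it is given as a ring morphism of the ambient field mapping the
    cluster algebra onto itself (injectivity is automatic).  It is a cluster
    automorphism if it maps some cluster to a cluster (seeds being labelled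
    here, up to a relabelling [s]) compatibly with mutation in all
    directions. *)
Definition cluster_automorphism (N : nat) (Q : quiver N)
    (f : {rmorphism ambient N -> ambient N}) : Prop :=
  [/\ forall g, cluster_algebra Q g -> cluster_algebra Q (f g),
      forall g, cluster_algebra Q g -> exists2 h, cluster_algebra Q h & f h = g
    & exists (S S' : seed N) (s : 'S_N),
        [/\ is_seed Q S, is_seed Q S',
            forall i, f (cluster S i) = cluster S' (s i)
          & forall k, f (cluster (mutate S k) k)
                      = cluster (mutate S' (s k)) (s k)]].

Definition coxeter_automorphism (N : nat) (Q : quiver N)
    (f : {rmorphism ambient N -> ambient N}) : Prop :=
  cluster_automorphism Q f /\
  forall t i, iter t f (initial_variable i)
              = cluster (iter t (@mu_c N) (initial_seed Q)) i.

(** [specializes a g c]: the rational function [g] is regular at [a], with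
    value [c] there. *)
Definition specializes (K : numFieldType) (N : nat) (a : 'rV[K]_N)
    (g : ambient N) (c : K) : Prop :=
  exists p q : {mpoly rat[N]},
    [/\ mmap ratr (a 0) q != 0,
        g = tofrac p / tofrac q
      & c = mmap ratr (a 0) p / mmap ratr (a 0) q].

(** X(Q, f, a); the quiver only enters through [f]. *)
Definition frieze_variety (K : numFieldType) (N : nat)
    (f : {rmorphism ambient N -> ambient N}) (a : 'rV[K]_N) : set 'rV[K]_N :=
  zariski_closure
    [set v : 'rV[K]_N | exists t : nat, forall i : 'I_N,
       specializes a (iter t f (initial_variable i)) (v 0 i)]%classic.

(** Arrows are listed with vertices labelled 1, ..., N; the vertex labelled
    [i.+1] is [i : 'I_N].  Repetitions in the list are multiple arrows, which
    occur for the Kronecker quiver [Atilde 1 1]. *)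

Definition quiver_of_arrows (N : nat) (s : seq (nat * nat)) : quiver N :=
  \matrix_(i, j) count_mem (i.+1, j.+1) s.

Definition path_arrows (s : seq nat) : seq (nat * nat) := zip s (behead s).

Definition Atilde_arrows (p q : nat) : seq (nat * nat) :=
  path_arrows ((p + q)%N :: rev (iota 1 q))
  ++ path_arrows (rcons (rev (iota q.+1 p)) 1%N).

Definition Dtilde_arrows (n : nat) : seq (nat * nat) :=
  [:: (3, 1); (3, 2)]%N
  ++ path_arrows (rev (iota 3 (n - 4)))
  ++ [:: (n, n - 2); (n - 1, n - 2)]%N.

Definition E6tilde_arrows : seq (nat * nat) :=
  path_arrows [:: 7; 2; 1]%N
  ++ path_arrows [:: 7; 4; 3]%N
  ++ path_arrows [:: 7; 6; 5]%N.

Definition E7tilde_arrows : seq (nat * nat) :=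
  path_arrows [:: 8; 3; 2; 1]%N
  ++ path_arrows [:: 8; 6; 5; 4]%N
  ++ path_arrows [:: 8; 7]%N.

Definition E8tilde_arrows : seq (nat * nat) :=
  path_arrows [:: 9; 5; 4; 3; 2; 1]%N
  ++ path_arrows [:: 9; 8; 7]%N
  ++ path_arrows [:: 9; 6]%N.

Inductive affine_quiver : forall N : nat, quiver N -> Prop :=
| affine_A (p q : nat) : (1 <= p)%N -> (1 <= q)%N ->
    affine_quiver (quiver_of_arrows (p + q) (Atilde_arrows p q))
| affine_D (n : nat) : (5 <= n)%N ->
    affine_quiver (quiver_of_arrows n (Dtilde_arrows n))
| affine_E6 : affine_quiver (quiver_of_arrows 7 E6tilde_arrows)
| affine_E7 : affine_quiver (quiver_of_arrows 8 E7tilde_arrows)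
| affine_E8 : affine_quiver (quiver_of_arrows 9 E8tilde_arrows).

(* Main.v *)
Require Import Defs.
From Stdlib Require Import BinInt.
From HB Require Import structures.
From mathcomp Require Import all_boot all_order all_fingroup all_algebra.
From mathcomp Require Import boolp classical_sets reals.
From mathcomp Require Import complex.
From mathcomp Require Import mpoly.
From mathcomp Require Import zify ssrZ ring lra.

Set Implicit Arguments.
Unset Strict Implicit.
Unset Printing Implicit Defensive.

Import Order.TTheory GRing.Theory Num.Theory.
Local Open Scope ring_scope.

(* At x = (1, ..., 1) the iterates of [f_c] are positive rationals y_t solving the
   exchange recurrence.  For a suitable period m and a rational K > 2, along each
   residue class t = r + m s every coordinate of y_t is a polynomial in sequences
   with g(s+2) = K g(s+1) - g(s), i.e. a Laurent polynomial in z = l^s where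
   l + 1/l = K, and conversely z and 1/z are polynomials in the coordinates.
   Hence the points of a residue class are dense in a closed curve isomorphic to
   the torus C^*, which is irreducible and smooth, and the frieze variety is the
   union of these m curves.

   For type A the frieze unfolds to an SL2-tiling periodic along a lattice
   vector, so that its rows solve g(i+2) = c_i g(i+1) - g(i) with periodic c (a
   discrete Hill equation); the trace of the monodromy is K.  For type D the two
   ends of the quiver are solutions of such an equation too, and the spine is a
   bilinear expression in one of them, as for arcs in a twice punctured disc.  For
   type E the coordinates are found as explicit binary forms in two consecutive
   terms of a recurrent sequence, and the exchange relations are checked by
   computation. *)

(** * Zariski closed sets *)

(** A Laurent parametrization of a curve may have cusps, self-crossings, or limit points outside its
    image. A polynomial left inverse excludes all three at once: when z and 1/z are polynomials in
    the coordinates, the image is closed, the map is injective, and its velocity pairs to 1 with the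
    gradient of the polynomial that reads off z. This is why every type must exhibit two independent
    recurrent sequences inside the algebra generated by the coordinates; recurrence of the
    coordinates alone would not suffice.

    The bound K > 2 makes l real and larger than 1, so that its powers are infinitely many points of
    the torus; identities of Laurent functions, and of their derivatives, then follow from the
    values at z = l^s. In types A and D the bound comes from positivity of the frieze, through the
    strict log-convexity of a sequence sampled once per period. The frieze itself stays rational,
    and l enters only when the curve is formed. *)

Section Zariski.
Variables (K : fieldType) (N : nat).
Implicit Types (X Y Z : set 'rV[K]_N) (x : 'rV[K]_N).

Lemma zariski_closureE X : zariski_closure X = zero_locus (vanishing_ideal X).
Proof.
apply/seteqP; split=> x /=.
  by apply=> [|y Xy p]; [exists (vanishing_ideal X) | exact].
by move=> Hx Z [I ->] XI p Ip; apply: Hx => y /XI; apply.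
Qed.

Lemma sub_zariski_closure X : (X `<=` zariski_closure X)%classic.
Proof. by move=> x Xx Z _; apply. Qed.

Lemma zariski_closed_closure X : zariski_closed (zariski_closure X).
Proof. by exists (vanishing_ideal X); rewrite zariski_closureE. Qed.

Lemma zariski_closedP Z x :
  zariski_closed Z -> (forall p, vanishing_ideal Z p -> p.@[x 0] = 0) -> Z x.
Proof. by move=> [S ->] H p Sp; apply: H => y; apply. Qed.

Lemma not_zariski_closed Z x : zariski_closed Z -> ~ Z x ->
  exists2 p, vanishing_ideal Z p & p.@[x 0] != 0.
Proof.
move=> cZ nZx; apply: contrapT => H; apply: nZx; apply: zariski_closedP => // p Zp.
by apply/eqP; apply: contrapT => /negP px; apply: H; exists p.
Qed.

Lemma zariski_closed0 : zariski_closed (set0 : set 'rV[K]_N).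
Proof.
exists setT; apply/seteqP; split=> // x /(_ 1 I) /eqP.
by rewrite meval1 oner_eq0.
Qed.

Lemma zariski_closedU Z1 Z2 : zariski_closed Z1 -> zariski_closed Z2 ->
  zariski_closed (Z1 `|` Z2)%classic.
Proof.
move=> c1 c2; exists (vanishing_ideal (Z1 `|` Z2)%classic).
apply/seteqP; split=> x; first by move=> Zx p; apply.
move=> Hx; apply: contrapT => /not_orP [n1 n2].
have [p1 Zp1 p1x] := not_zariski_closed c1 n1.
have [p2 Zp2 p2x] := not_zariski_closed c2 n2.
have /eqP : (p1 * p2).@[x 0] = 0.
  by apply: Hx => y []; [move/Zp1|move/Zp2]; rewrite mevalM => ->; rewrite (mul0r, mulr0).
by rewrite mevalM mulf_eq0 (negbTE p1x) (negbTE p2x).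
Qed.

Lemma zariski_closed_bigcup (Z : nat -> set 'rV[K]_N) m :
  (forall r, (r < m)%N -> zariski_closed (Z r)) ->
  zariski_closed [set x | exists2 r, (r < m)%N & Z r x]%classic.
Proof.
elim: m => [_|m IH cZ].
  suff -> : [set x | exists2 r, (r < 0)%N & Z r x]%classic = set0.
    exact: zariski_closed0.
  by apply/seteqP; split=> // x [r].
suff -> : [set x | exists2 r, (r < m.+1)%N & Z r x]%classic
        = ([set x | exists2 r, (r < m)%N & Z r x] `|` Z m)%classic.
  apply: zariski_closedU; last exact: cZ.
  by apply: IH => r rm; apply: cZ; apply: ltnW.
apply/seteqP; split=> x [].
- by move=> r; rewrite ltnS leq_eqVlt => /orP [/eqP ->|rm] Zr; [right|left; exists r].
- by move=> [r rm Zr]; exists r => //; apply: ltnW.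
- by exists m.
Qed.

Lemma zariski_irreducible_bigcup Y (Z : nat -> set 'rV[K]_N) m :
  zariski_irreducible Y -> (forall r, (r < m)%N -> zariski_closed (Z r)) ->
  (forall x, Y x -> exists2 r, (r < m)%N & Z r x) ->
  exists2 r, (r < m)%N & (Y `<=` Z r)%classic.
Proof.
move=> [[y0 Yy0] irrY]; elim: m => [|m IH] cZ cov; first by have [r] := cov _ Yy0.
have cZm r : (r < m)%N -> zariski_closed (Z r) by move=> rm; apply: cZ; apply: ltnW.
case: (irrY _ _ (zariski_closed_bigcup cZm) (cZ m (ltnSn m))) => [x Yx|YZ|YZ].
- have [r] := cov _ Yx.
  by rewrite ltnS leq_eqVlt => /orP [/eqP ->|rm] Zr; [right|left; exists r].
- by have [r rm Yr] := IH cZm YZ; exists r => //; apply: ltnW.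
- by exists m.
Qed.

(** The closures of the classes are finitely many closed sets covering the whole, so a component
    lies in one of them and maximality forces equality. Distinct classes may have the same
    closure. *)
Lemma irreducible_component_closure_periodic (v : nat -> 'rV[K]_N) m Y :
  (0 < m)%N ->
  (forall r, (r < m)%N ->
     zariski_irreducible (zariski_closure (range (fun s => v (r + m * s)%N)))) ->
  irreducible_component (zariski_closure (range v)) Y ->
  exists2 r, (r < m)%N &
    Y = zariski_closure (range (fun s => v (r + m * s)%N)).
Proof.
move=> m0 irr [irrY YX maxY].
pose Z r := zariski_closure (range (fun s => v (r + m * s)%N)).
have cZ r : (r < m)%N -> zariski_closed (Z r) by move=> _; apply: zariski_closed_closure.
have ZX r : (Z r `<=` zariski_closure (range v))%classic.
  move=> x Zx W cW vW; apply: Zx => // _ [s _ <-]; apply: vW.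
  by exists (r + m * s)%N.
have [|r rm YZ] := zariski_irreducible_bigcup irrY cZ.
  move=> x /YX /(_ _ (zariski_closed_bigcup cZ)); apply => _ [t _ <-] /=.
  exists (t %% m)%N; first by rewrite ltn_mod.
  apply: sub_zariski_closure; exists (t %/ m)%N => //.
  by rewrite mulnC addnC -divn_eq.
exists r => //; apply/seteqP; split=> //; apply: maxY => //; [exact: irr | exact: ZX].
Qed.

Lemma vanishing_ideal_closure X p :
  vanishing_ideal X p -> vanishing_ideal (zariski_closure X) p.
Proof. by move=> Xp x; rewrite zariski_closureE; apply. Qed.

Lemma zariski_closed1 x : zariski_closed [set x]%classic.
Proof.
exists [set p | exists i, p = 'X_i - (x 0 i)%:MP]%classic.
apply/seteqP; split=> y /=.
  by move=> -> _ [i ->]; rewrite mevalB mevalXU mevalC subrr.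
move=> H; apply/rowP => i; apply/eqP; rewrite -subr_eq0; apply/eqP.
have := H _ (ex_intro _ i erefl).
by rewrite mevalB mevalXU mevalC.
Qed.

Lemma zariski_irreducible1 x : zariski_irreducible [set x]%classic.
Proof.
split; first by exists x.
by move=> Z1 Z2 _ _ /(_ x erefl) [Zx|Zx]; [left|right] => y ->.
Qed.

End Zariski.

(** * Laurent polynomial functions *)

Section Laurent.
Variable K : fieldType.

(** The second function is the formal derivative, by the quotient rule for P / z^M. Carrying it in
    the same predicate lets agreement at the powers of [l] yield agreement of the derivatives as
    well. *)
Definition laurent (f df : K -> K) : Prop :=
  exists (P : {poly K}) (M : nat), forall z : K, z != 0 ->
    f z = P.[z] / z ^+ M /\
    df z = (P^`().[z] * z - P.[z] *+ M) / z ^+ M.+1.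

Lemma laurent_ext f df g dg : laurent f df ->
  (forall z : K, z != 0 -> g z = f z) -> (forall z : K, z != 0 -> dg z = df z) ->
  laurent g dg.
Proof.
by move=> [P [M H]] fg dfg; exists P, M => z z0; rewrite fg ?dfg //; apply: H.
Qed.

Lemma laurent_cst c : laurent (fun=> c) (fun=> 0).
Proof.
by exists c%:P, 0%N => z z0; rewrite derivC !hornerE ?(mulr0n, mul0r, subrr, oppr0) expr0 divr1.
Qed.

Lemma laurent_id : laurent id (fun=> 1).
Proof.
by exists 'X, 0%N => z z0; rewrite derivX !hornerE mulr0n; split; field; rewrite ?oner_eq0.
Qed.

Lemma laurent_inv : laurent (fun z => z^-1) (fun z => - z ^- 2).
Proof. by exists 1, 1%N => z z0; rewrite derivC !hornerE; split; field. Qed.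

Lemma laurentD f df g dg : laurent f df -> laurent g dg ->
  laurent (fun z => f z + g z) (fun z => df z + dg z).
Proof.
move=> [P [M HP]] [L [n HL]]; exists (P * 'X^n + L * 'X^M), (M + n)%N => z z0.
have [-> ->] := HP z z0; have [-> ->] := HL z z0.
have XE k : ('X^k : {poly K})^`().[z] = z ^+ k *+ k / z.
  rewrite derivXn hornerMn hornerXn; case: k => [|k]; first by rewrite !mulr0n mul0r.
  by rewrite /= exprS; field.
have a0 := expf_neq0 M z0; have b0 := expf_neq0 n z0.
have [k kE] : exists k : K, forall w, w *+ M = w * k by exists M%:R => w; rewrite mulr_natr.
have [l lE] : exists l : K, forall w, w *+ n = w * l by exists n%:R => w; rewrite mulr_natr.
rewrite derivD !derivM !hornerD !hornerM !XE !hornerXn mulrnDr !kE !lE !exprS !exprD.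
move: (z ^+ M) (z ^+ n) a0 b0 => a b a0 b0.
move: P.[z] L.[z] P^`().[z] L^`().[z] => x y x' y'.
by split; field; rewrite ?z0 ?a0 ?b0.
Qed.

Lemma laurentM f df g dg : laurent f df -> laurent g dg ->
  laurent (fun z => f z * g z) (fun z => df z * g z + f z * dg z).
Proof.
move=> [P [M HP]] [L [n HL]]; exists (P * L), (M + n)%N => z z0.
have [-> ->] := HP z z0; have [-> ->] := HL z z0.
have a0 := expf_neq0 M z0; have b0 := expf_neq0 n z0.
have [k kE] : exists k : K, forall w, w *+ M = w * k by exists M%:R => w; rewrite mulr_natr.
have [l lE] : exists l : K, forall w, w *+ n = w * l by exists n%:R => w; rewrite mulr_natr.
rewrite !derivM !hornerD !hornerM mulrnDr !kE !lE !exprS !exprD.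
move: (z ^+ M) (z ^+ n) a0 b0 => a b a0 b0.
move: P.[z] L.[z] P^`().[z] L^`().[z] => x y x' y'.
by split; field; rewrite ?z0 ?a0 ?b0.
Qed.

(** The numerator has the infinitely many distinct roots [l ^+ s], so it is the zero polynomial; the
    derivative is made from the same numerator. *)
Lemma laurent0 (l : K) f df : l != 0 -> injective (fun n => l ^+ n) ->
  laurent f df -> (forall s, f (l ^+ s) = 0) ->
  forall z : K, z != 0 -> f z = 0 /\ df z = 0.
Proof.
move=> l0 linj [P [M H]] fl.
suff P0 : P = 0.
  by move=> z /H [-> ->]; rewrite P0 deriv0 !horner0 !(mul0r, mul0rn, subrr).
apply/eqP; apply: contraT => nP.
have := max_poly_roots nP (rs := [seq l ^+ s | s <- iota 0 (size P)]).
rewrite size_map size_iota ltnn; apply.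
  apply/allP => _ /mapP [s _ ->]; rewrite rootE.
  have [] := H (l ^+ s) (expf_neq0 _ l0); rewrite fl => /esym /eqP + _.
  by rewrite mulf_eq0 invr_eq0 !expf_eq0 (negbTE l0) !andbF orbF.
by rewrite map_inj_uniq ?iota_uniq.
Qed.

Lemma laurent_inj (l : K) f df g dg : l != 0 -> injective (fun n => l ^+ n) ->
  laurent f df -> laurent g dg -> (forall s, f (l ^+ s) = g (l ^+ s)) ->
  forall z : K, z != 0 -> f z = g z /\ df z = dg z.
Proof.
move=> l0 linj lf lg fg z z0.
have := laurent0 l0 linj (laurentD lf (laurentM (laurent_cst (-1)) lg)) _ z0.
case=> [s|]; first by rewrite fg mulN1r subrr.
by rewrite mul0r add0r !mulN1r => /eqP + /eqP; rewrite !subr_eq0 => /eqP -> /eqP ->.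
Qed.

End Laurent.

(** * Polynomials restricted to a curve and their directional derivatives *)

Lemma mpoly_ring_ind (R : comNzRingType) n (P : {mpoly R[n]} -> Prop) :
  (forall c, P c%:MP) -> (forall i, P 'X_i) ->
  (forall p q, P p -> P q -> P (p + q)) -> (forall p q, P p -> P q -> P (p * q)) ->
  forall p, P p.
Proof.
move=> PC PX PD PM; apply: mpolyind => [|c m p _ _ Pp]; first exact: (PC 0).
apply: PD Pp; rewrite -mul_mpolyC mpolyXE_id; apply: (PM) => //.
apply: big_ind => [|p1 p2|i _]; [exact: (PC 1) | exact: PM|].
by elim: (m i) => [|k IH]; [exact: (PC 1) | rewrite exprS; apply: PM].
Qed.

Section DirectionalDerivative.
Variables (K : fieldType) (N : nat) (a u : 'I_N -> K).

Definition dirder (p : {mpoly K[N]}) : K := \sum_(i < N) p^`M(i).@[a] * u i.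

Lemma dirderC c : dirder c%:MP = 0.
Proof. by apply: big1 => i _; rewrite mderivC meval0 mul0r. Qed.

Lemma dirderX i : dirder 'X_i = u i.
Proof.
rewrite /dirder (bigD1 i) //= mderivX mnm1E eqxx scale1r.
rewrite (_ : U_(i) - U_(i) = 0)%MM ?mpolyX0 ?meval1 ?mul1r; last first.
  by apply/mnmP => j; rewrite mnmBE mnm0E subnn.
rewrite big1 ?addr0 // => j ji.
by rewrite mderivX mnm1E eq_sym (negbTE ji) scale0r meval0 mul0r.
Qed.

Lemma dirderD p q : dirder (p + q) = dirder p + dirder q.
Proof.
by rewrite -big_split; apply: eq_bigr => i _; rewrite mderivD mevalD mulrDl.
Qed.

Lemma dirderM p q : dirder (p * q) = dirder p * q.@[a] + p.@[a] * dirder q.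
Proof.
rewrite mulr_suml mulr_sumr -big_split; apply: eq_bigr => i _ /=.
by rewrite mderivM mevalD !mevalM; ring.
Qed.

Lemma dirderN p : dirder (- p) = - dirder p.
Proof. by rewrite -sumrN; apply: eq_bigr => i _; rewrite mderivN mevalN mulNr. Qed.

Lemma dirder_exp p n : dirder (p ^+ n) = dirder p * p.@[a] ^+ n.-1 *+ n.
Proof.
elim: n => [|n IH]; first by rewrite expr0 mulr0n -[1]/(1%:MP) dirderC.
rewrite exprS dirderM IH rmorphXn /=.
by case: n {IH} => [|n]; rewrite ?expr0 /= ?exprS -?[n.+2]addn1 ?mulrnDr; ring.
Qed.

Lemma meval_horner (P : {poly K}) p :
  (map_poly (@mpolyC N K) P).[p].@[a] = P.[p.@[a]].
Proof.
elim/poly_ind: P => [|P c IH]; first by rewrite rmorph0 !horner0 meval0.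
by rewrite rmorphD rmorphM /= map_polyX map_polyC !hornerE mevalD mevalM IH mevalC.
Qed.

Lemma dirder_horner (P : {poly K}) p :
  dirder (map_poly (@mpolyC N K) P).[p] = P^`().[p.@[a]] * dirder p.
Proof.
elim/poly_ind: P => [|P c IH].
  by rewrite rmorph0 deriv0 !horner0 mul0r -[0]/(0%:MP) dirderC.
rewrite rmorphD rmorphM /= map_polyX map_polyC derivD derivC derivM derivX !hornerE.
by rewrite dirderD dirderM dirderC IH meval_horner; ring.
Qed.

End DirectionalDerivative.

(** * Curves parametrized by the torus *)

Section TorusCurve.
Variables (K : fieldType) (N : nat) (l : K) (f df : 'I_N -> K -> K).
Variables (psi eta : {mpoly K[N]}) (v : nat -> 'rV[K]_N).
Hypothesis l_neq0 : l != 0.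
Hypothesis l_inj : injective (fun n : nat => l ^+ n).
Hypothesis f_laurent : forall i, laurent (f i) (df i).
Hypothesis vE : forall s i, v s 0 i = f i (l ^+ s).
Hypothesis psiE : forall s, psi.@[v s 0] = l ^+ s.
Hypothesis etaE : forall s, eta.@[v s 0] = l ^- s.

Let pt z : 'rV[K]_N := \row_i f i z.
Let Z := zariski_closure (range v).

Let meval_pt p z : p.@[pt z 0] = p.@[fun i => f i z].
Proof. by apply: meval_eq => i; rewrite mxE. Qed.

Let v_pt s : v s = pt (l ^+ s).
Proof. by apply/rowP => i; rewrite mxE vE. Qed.

Let exp_l_neq0 s : l ^+ s != 0. Proof. exact: expf_neq0. Qed.

(** Chain rule: pulling [p] back to the torus and differentiating gives its directional derivative
    along the velocity [df]. *)
Lemma laurent_meval p :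
  laurent (fun z => p.@[fun i => f i z])
          (fun z => dirder (fun i => f i z) (fun i => df i z) p).
Proof.
elim/mpoly_ring_ind: p => [c|i|p q Hp Hq|p q Hp Hq].
- by apply: laurent_ext (laurent_cst c) _ _ => z _; rewrite ?mevalC ?dirderC.
- by apply: laurent_ext (f_laurent i) _ _ => z _; rewrite ?mevalXU ?dirderX.
- by apply: laurent_ext (laurentD Hp Hq) _ _ => z _; rewrite ?mevalD ?dirderD.
- by apply: laurent_ext (laurentM Hp Hq) _ _ => z _; rewrite ?mevalM ?dirderM.
Qed.

Lemma vanishing_torus_curve p : (forall s, p.@[v s 0] = 0) ->
  forall z, z != 0 ->
  p.@[pt z 0] = 0 /\ dirder (fun i => f i z) (fun i => df i z) p = 0.
Proof.
move=> pv z z0; rewrite meval_pt; apply: (laurent0 l_neq0 l_inj (laurent_meval p)) => // s.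
by rewrite -meval_pt -v_pt.
Qed.

Lemma torus_curve_pt z : z != 0 -> Z (pt z).
Proof.
move=> z0; rewrite /Z zariski_closureE => p Ip.
by have [] := vanishing_torus_curve (fun s => Ip _ (imageP v I)) z0.
Qed.

Let psi_pt z : z != 0 -> psi.@[pt z 0] = z.
Proof.
move=> z0; rewrite meval_pt.
apply: (laurent_inj l_neq0 l_inj (laurent_meval psi) (laurent_id K) _ z0).1 => s.
by rewrite -meval_pt -v_pt psiE.
Qed.

(** Obtained by differentiating [psi_pt]; it shows that the velocity is never zero, so the curve has
    no cusp. *)
Let dpsi_pt z : z != 0 -> dirder (fun i => f i z) (fun i => df i z) psi = 1.
Proof.
move=> z0; apply: (laurent_inj l_neq0 l_inj (laurent_meval psi) (laurent_id K) _ z0).2 => s.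
by rewrite -meval_pt -v_pt psiE.
Qed.

Let eta_pt z : z != 0 -> eta.@[pt z 0] = z^-1.
Proof.
move=> z0; rewrite meval_pt.
apply: (laurent_inj l_neq0 l_inj (laurent_meval eta) (laurent_inv K) _ z0).1 => s.
by rewrite -meval_pt -v_pt etaE.
Qed.

Let vanishZ p : (forall s, p.@[v s 0] = 0) -> vanishing_ideal Z p.
Proof. by move=> pv; apply: vanishing_ideal_closure => _ [s _ <-]. Qed.

(* The equations of the curve: [z] and [1/z] are read off by [psi] and [eta],
   and every coordinate is a polynomial in these two. *)
Let eqn0 : vanishing_ideal Z (psi * eta - 1).
Proof.
by apply: vanishZ => s; rewrite mevalB mevalM psiE etaE meval1 divff ?subrr.
Qed.

Let eqn i (P : {poly K}) M : (forall z, z != 0 ->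
    f i z = P.[z] / z ^+ M /\ df i z = (P^`().[z] * z - P.[z] *+ M) / z ^+ M.+1) ->
  vanishing_ideal Z ('X_i - (map_poly (@mpolyC N K) P).[psi] * eta ^+ M).
Proof.
move=> H; apply: vanishZ => s.
rewrite mevalB mevalM rmorphXn /= mevalXU meval_horner psiE etaE vE.
by have [-> _] := H _ (exp_l_neq0 s); rewrite exprVn subrr.
Qed.

(** The equations [eqn0] and [eqn] force [x] to be the point with parameter [psi.@[x 0]]: the image
    of the torus is already closed. *)
Lemma torus_curveP x : Z x -> exists2 z, z != 0 & x = pt z.
Proof.
move=> Zx; exists psi.@[x 0].
  have := eqn0 Zx; rewrite mevalB mevalM meval1 => /eqP; rewrite subr_eq0 => /eqP H.
  by apply: contra_eq_neq H => ->; rewrite mul0r eq_sym oner_neq0.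
have := eqn0 Zx; rewrite mevalB mevalM meval1 => /eqP; rewrite subr_eq0 => /eqP H.
have p0 : psi.@[x 0] != 0 by apply: contra_eq_neq H => ->; rewrite mul0r eq_sym oner_neq0.
apply/rowP => i; rewrite mxE.
have [P [M HP]] := f_laurent i; have [-> _] := HP _ p0.
have /eqP := eqn HP Zx.
rewrite mevalB mevalM rmorphXn /= mevalXU meval_horner subr_eq0 => /eqP ->.
by rewrite -exprVn -[eta.@[_]](mulKf p0) H mulr1.
Qed.

(** The numerators of pulled-back polynomials live in an integral domain, and a product vanishing at
    all [l ^+ s] is the zero polynomial. *)
Lemma torus_curve_irreducible : zariski_irreducible Z.
Proof.
split; first by exists (v 0%N); apply: sub_zariski_closure; exists 0%N.
move=> Z1 Z2 c1 c2 ZU; apply: contrapT => /not_orP [].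
move=> /existsNP [x1 /not_implyP [Zx1 n1]] /existsNP [x2 /not_implyP [Zx2 n2]].
have [p1 I1 nz1] := not_zariski_closed c1 n1.
have [p2 I2 nz2] := not_zariski_closed c2 n2.
have p12 s : (p1 * p2).@[v s 0] = 0.
  have /ZU [Y|Y] : Z (v s) by apply: sub_zariski_closure; exists s.
    by rewrite mevalM I1 ?mul0r.
  by rewrite mevalM I2 ?mulr0.
have [z1 z10 E1] := torus_curveP Zx1; have [z2 z20 E2] := torus_curveP Zx2.
have [P1 [M1 H1]] := laurent_meval p1; have [P2 [M2 H2]] := laurent_meval p2.
suff /eqP : P1 * P2 = 0.
  rewrite mulf_eq0 => /orP [] /eqP P0; [move: nz1|move: nz2].
    by rewrite E1 meval_pt (H1 _ z10).1 P0 horner0 mul0r eqxx.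
  by rewrite E2 meval_pt (H2 _ z20).1 P0 horner0 mul0r eqxx.
apply/eqP; apply: contraT => nP.
have := max_poly_roots nP (rs := [seq l ^+ s | s <- iota 0 (size (P1 * P2))]).
rewrite size_map size_iota ltnn; apply; last by rewrite map_inj_uniq ?iota_uniq.
apply/allP => _ /mapP [s _ ->]; rewrite rootE hornerM.
have /eqP := p12 s; rewrite v_pt mevalM !meval_pt (H1 _ (exp_l_neq0 s)).1 (H2 _ (exp_l_neq0 s)).1.
by rewrite !mulf_eq0 !invr_eq0 !(negbTE (expf_neq0 _ (exp_l_neq0 s))) !orbF.
Qed.

(** A polynomial vanishing on [W] but not on the curve pulls back to a nonzero numerator. Splitting
    off its root [zx] covers [W] by the closed sets psi = zx and Q(psi) = 0; irreducibility leaves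
    only the first, since Q does not vanish at [zx]. *)
Lemma torus_curve_proper_subset (W : set 'rV[K]_N) :
  zariski_closed W -> zariski_irreducible W -> (W `<` Z)%classic ->
  forall x y, W x -> W y -> x = y.
Proof.
move=> cW [_ irrW] [WZ nZW] x y Wx Wy.
have /existsNP [x0 /not_implyP [Zx0 nWx0]] : ~ (Z `<=` W)%classic by [].
have [p Ip nz] := not_zariski_closed cW nWx0.
have [z0 z0n Ex0] := torus_curveP Zx0; have [zx zxn Ex] := torus_curveP (WZ _ Wx).
have [P [M HP]] := laurent_meval p.
have P0 : P != 0.
  by apply: contraNneq nz => P0; rewrite Ex0 meval_pt (HP _ z0n).1 P0 horner0 mul0r.
have rootW z : z != 0 -> W (pt z) -> root P z.
  move=> zn Wz; rewrite rootE; have /eqP := Ip _ Wz; rewrite meval_pt (HP _ zn).1.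
  by rewrite mulf_eq0 invr_eq0 expf_eq0 (negbTE zn) andbF orbF.
have [m [Q]] := multiplicity_XsubC P zx; rewrite P0 => nQ EP.
pose V (q : {mpoly K[N]}) := zero_locus [set q]%classic.
have cV q : zariski_closed (V q) by exists [set q]%classic.
have VE q w : V q w <-> q.@[w 0] = 0 by split=> [/(_ q erefl)|H _ ->].
have [w Ww|Wa|Wb] := irrW _ _ (cV (psi - zx%:MP))
    (cV (map_poly (@mpolyC N K) Q).[psi]).
- have [z zn Ew] := torus_curveP (WZ _ Ww); move: Ww; rewrite Ew => /(rootW _ zn).
  rewrite EP rootM => /orP [rQ|rX]; [right|left]; apply/VE.
    by rewrite meval_horner psi_pt //; apply/eqP.
  rewrite mevalB mevalC psi_pt //; apply/eqP; rewrite subr_eq0; move: rX.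
  by rewrite /root horner_exp hornerXsubC expf_eq0 subr_eq0 => /andP [].
- have [zy zyn Ey] := torus_curveP (WZ _ Wy).
  have /VE := Wa _ Wy; rewrite mevalB mevalC Ey psi_pt // => /eqP.
  by rewrite subr_eq0 Ex => /eqP ->.
- have /VE := Wb _ Wx; rewrite meval_horner Ex psi_pt // => /eqP H.
  by rewrite /root H in nQ.
Qed.

Lemma torus_curve_dim : krull_dim_is Z 1.
Proof.
have cZ : zariski_closed Z := @zariski_closed_closure _ _ _.
have Z1 : Z (pt 1) by apply: torus_curve_pt; apply: oner_neq0.
split.
  exists (fun k => if k is 0 then [set pt 1]%classic else Z); split=> [[_|k _]|[_|//]].
  - by split; [exact: zariski_closed1 | exact: zariski_irreducible1 | move=> _ ->].
  - by split=> //; exact: torus_curve_irreducible.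
  split=> [_ -> //|ZE].
  have /(congr1 (fun x : 'rV[K]_N => psi.@[x 0])) : pt l = pt 1.
    by apply: ZE; apply: torus_curve_pt.
  rewrite !psi_pt ?oner_neq0 // => l1.
  by have := l_inj (x1 := 1%N) (x2 := 0%N); rewrite expr1 expr0 => /(_ l1).
(* In a longer chain [W 1] is an irreducible proper closed subset, hence a point, which leaves no
   room for a smaller nonempty [W 0]. *)
move=> [|[|d]] W [HW ltW] //.
have [cW irrW W1Z] := HW 1%N isT; have [_ [[a Wa] _] _] := HW 0%N isT.
have [W01 nW10] := ltW 0%N isT; have [W12 nW21] := ltW 1%N isT.
have [_ _ W2Z] := HW 2%N isT.
case: nW10 => b Wb; suff -> : b = a by [].
apply: (torus_curve_proper_subset cW irrW) => //; last exact: W01.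
by split=> // ZW; apply: nW21 => x /W2Z /ZW.
Qed.

(** The tangent space is the line of the velocity. For a tangent vector [u], differentiating psi *
    eta = 1 expresses D eta through D psi, and differentiating the equation of each coordinate then
    gives [u] as D psi times the velocity. *)
Lemma torus_curve_smooth : smooth_variety Z.
Proof.
exists 1%N; first exact: torus_curve_dim.
move=> a Za; have [z z0 Ea] := torus_curveP Za.
pose tau : 'rV[K]_N := \row_i df i z.
have dirderE p u : \sum_(i < N) (p^`M(i)).@[a 0] * u 0 i
    = dirder (fun i => f i z) (fun i => u 0 i) p.
  by apply: eq_bigr => i _; rewrite Ea meval_pt.
have dirder_tau p : dirder (fun i => f i z) (fun i => tau 0 i) p
    = dirder (fun i => f i z) (fun i => df i z) p.
  by apply: eq_bigr => i _; rewrite mxE.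
exists <[tau]>%VS => [u|]; last first.
  rewrite dim_vline; suff -> : tau != 0 by [].
  apply/eqP => tau0; have := dpsi_pt z0; rewrite -dirder_tau tau0 /dirder big1 => [/eqP|i _].
    by rewrite eq_sym oner_eq0.
  by rewrite mxE mulr0.
split.
  case/vlineP => c -> p Ip; rewrite dirderE /dirder.
  under eq_bigr => i _ do rewrite mxE mulrCA.
  rewrite -mulr_sumr -/(dirder _ _ p) dirder_tau.
  rewrite (vanishing_torus_curve _ z0).2 ?mulr0 // => s.
  by apply: Ip; apply: sub_zariski_closure; exists s.
move=> Tu; pose D := dirder (fun i => f i z) (fun i => u 0 i).
have TD p : vanishing_ideal Z p -> D p = 0 by move=> /Tu; rewrite dirderE.
have psiz : psi.@[fun i => f i z] = z by rewrite -meval_pt psi_pt.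
have etaz : eta.@[fun i => f i z] = z^-1 by rewrite -meval_pt eta_pt.
have Deta : D eta = - D psi / z ^+ 2.
  have := TD _ eqn0.
  rewrite /D dirderD dirderM dirderN -[1]/(1%:MP) dirderC subr0 psiz etaz -!/(D _) => H.
  apply: (mulfI z0); rewrite -[LHS](addKr (D psi / z)) H; field.
  by rewrite z0.
apply/vlineP; exists (D psi); apply/rowP => i; rewrite !mxE.
have [P [M HP]] := f_laurent i; rewrite (HP _ z0).2.
have := TD _ (eqn HP).
rewrite /D dirderD dirderX dirderN dirderM dirder_horner dirder_exp meval_horner rmorphXn /=.
rewrite psiz etaz -!/(D _) Deta => /eqP; rewrite subr_eq0 => /eqP ->.
case: M {HP} => [|M]; first by rewrite !mulr0n /= !expr0; field.
have [k kE] : exists k : K, forall w, w *+ M.+1 = w * k.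
  by exists M.+1%:R => w; rewrite mulr_natr.
rewrite !kE /= !exprVn !exprS; move: (z ^+ M) (expf_neq0 M z0) => b b0.
by field; rewrite ?z0 ?b0.
Qed.

End TorusCurve.

(** * Recurrent sequences *)

Section SequenceAlgebra.
Variable R : comNzRingType.

(** The generators are a parameter because the notion serves both ways: the coordinates lie in the
    algebra of recurrent sequences, and two recurrent sequences lie in the algebra of the
    coordinates. *)
Inductive seq_alg (S : (nat -> R) -> Prop) : (nat -> R) -> Prop :=
| seq_alg_gen f : S f -> seq_alg S f
| seq_alg_cst c : seq_alg S (fun=> c)
| seq_algD f g : seq_alg S f -> seq_alg S g -> seq_alg S (fun s => f s + g s)
| seq_algM f g : seq_alg S f -> seq_alg S g -> seq_alg S (fun s => f s * g s).

Lemma seq_alg_ext S f g : seq_alg S f -> g =1 f -> seq_alg S g.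
Proof. by move=> Sf /funext ->. Qed.

Lemma seq_algZ S c f : seq_alg S f -> seq_alg S (fun s => c * f s).
Proof. by move=> Sf; apply: seq_algM => //; apply: seq_alg_cst. Qed.

Lemma seq_algB S f g : seq_alg S f -> seq_alg S g -> seq_alg S (fun s => f s - g s).
Proof.
move=> Sf Sg; apply: seq_alg_ext (seq_algD Sf (seq_algZ (-1) Sg)) _ => s.
by rewrite mulN1r.
Qed.

Definition lucas (k : R) (f : nat -> R) : Prop :=
  forall s, f s.+2 = k * f s.+1 - f s.

Lemma lucas_eq k f g : lucas k f -> lucas k g -> f 0%N = g 0%N -> f 1%N = g 1%N ->
  f =1 g.
Proof.
move=> lf lg e0 e1 s; suff: f s = g s /\ f s.+1 = g s.+1 by case.
by elim: s => [//|s [IH0 IH1]]; split=> //; rewrite lf lg IH0 IH1.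
Qed.

Lemma lucas_lin k f g a b : lucas k f -> lucas k g ->
  lucas k (fun s => a * f s + b * g s).
Proof. by move=> lf lg s; rewrite lf lg; ring. Qed.

End SequenceAlgebra.

Lemma lucas_exp (F : fieldType) (k l : F) : l != 0 -> l + l^-1 = k ->
  lucas k (fun s => l ^+ s).
Proof. by move=> l0 <- s; rewrite !exprS; field. Qed.

Lemma lucas_expV (F : fieldType) (k l : F) : l != 0 -> l + l^-1 = k ->
  lucas k (fun s => l ^- s).
Proof. by move=> l0 <- s; rewrite !exprS; field; rewrite ?expf_neq0 ?l0. Qed.

(** * The curve of a residue class, over the complex numbers *)

Section Specialization.
Variable R : realType.
Local Notation C := R[i].

(** The larger root of X^2 - K X + 1 is real and exceeds 1, so its powers increase strictly; it is
    built over [R] and then embedded. *)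
Lemma lucas_root (K : rat) : 2 < K ->
  exists l : C, [/\ l != 0, l + l^-1 = ratr K, l != l^-1
                  & injective (fun n : nat => l ^+ n)].
Proof.
move=> K2; have [k kE] : exists k : R, k = ratr K by exists (ratr K).
have k2 : 2 < k by rewrite kE -[2](ratr_nat R) ltr_rat.
pose d := Num.sqrt (k ^+ 2 - 4).
have d2 : d ^+ 2 = k ^+ 2 - 4.
  by rewrite sqr_sqrtr // (_ : _ - 4 = (k - 2) * (k + 2)); [apply: mulr_ge0; lra | ring].
have d0 : 0 <= d := sqrtr_ge0 _.
move: d d2 d0 => d d2 d0; pose r := (k + d) / 2.
have r1 : 1 < r by rewrite /r; lra.
have r0 : r != 0 by apply: lt0r_neq0; lra.
have rV : r + r^-1 = k.
  by apply: (mulfI r0); rewrite mulrDr divff // /r; lra.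
exists (r%:C)%C; rewrite -(fmorphV (real_complex R)).
have rC : {morph real_complex R : x y / x + y} := raddfD _.
split.
- by rewrite fmorph_eq0.
- by rewrite -rC rV kE fmorph_rat.
- apply/negP => /eqP /fmorph_inj rr.
  have rr1 : r * r = 1 by rewrite [X in _ * X]rr divff.
  by have /esym := exprn_egt1 2 r1; rewrite expr2 rr1 ltxx.
- move=> m n; rewrite -!rmorphXn /= => /fmorph_inj; apply: ieexprIn;
    [exact: lt_trans r1|by rewrite neq_lt r1 orbT].
Qed.

Lemma lucas_laurent (K : rat) (l : C) f : l != 0 -> l + l^-1 = ratr K -> l != l^-1 ->
  lucas K f -> exists F dF, laurent F dF /\ forall s, ratr (f s) = F (l ^+ s).
Proof.
move=> l0 lK ll lf; have dl : l - l^-1 != 0 by rewrite subr_eq0.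
(* Cramer's rule for a l^s + b l^-s at s = 0 and s = 1; this is where the two roots must differ. *)
pose a : C := (ratr (f 1%N) - ratr (f 0%N) / l) / (l - l^-1).
pose b : C := (ratr (f 0%N) * l - ratr (f 1%N)) / (l - l^-1).
exists (fun z => a * z + b * z^-1), (fun z => (0 * z + a * 1) + (0 * z^-1 + b * - z ^- 2)).
split.
  apply: laurentD; apply: laurentM; [exact: laurent_cst | exact: laurent_id |
    exact: laurent_cst | exact: laurent_inv].
have lrf : lucas (ratr K) (fun s => ratr (f s) : C).
  by move=> s; rewrite lf rmorphB rmorphM.
move=> s; have := lucas_eq lrf (lucas_lin a b (lucas_exp l0 lK) (lucas_expV l0 lK)).
have dl' : l * l - 1 != 0.
  have E : l - l^-1 = (l * l - 1) / l by field.
  by move: dl; rewrite E; apply: contraNneq => ->; rewrite mul0r.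
apply; rewrite ?expr0 ?expr1 ?invr1 /a /b; field; rewrite ?l0 ?dl' ?oner_eq0 //.
Qed.

Lemma seq_alg_laurent (K : rat) (l : C) f : l != 0 -> l + l^-1 = ratr K -> l != l^-1 ->
  seq_alg (lucas K) f -> exists F dF, laurent F dF /\ forall s, ratr (f s) = F (l ^+ s).
Proof.
move=> l0 lK ll; elim=> [g|c|g h _ [F [dF [LF HF]]] _ [G [dG [LG HG]]]
  |g h _ [F [dF [LF HF]]] _ [G [dG [LG HG]]]].
- exact: lucas_laurent.
- by exists (fun=> ratr c), (fun=> 0); split=> //; apply: laurent_cst.
- exists (fun z => F z + G z), (fun z => dF z + dG z); split; first exact: laurentD.
  by move=> s /=; rewrite rmorphD /= HF HG.
- exists (fun z => F z * G z), (fun z => dF z * G z + F z * dG z); split; first exact: laurentM.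
  by move=> s /=; rewrite rmorphM /= HF HG.
Qed.

Lemma seq_alg_mpoly N (y : nat -> 'I_N -> rat) f :
  seq_alg (fun g => exists i, forall s, g s = y s i) f ->
  exists p : {mpoly C[N]}, forall s, p.@[(\row_i ratr (y s i) : 'rV[C]_N) 0] = ratr (f s).
Proof.
elim=> [g [i gE]|c|g h _ [p Hp] _ [q Hq]|g h _ [p Hp] _ [q Hq]].
- by exists 'X_i => s; rewrite mevalXU mxE gE.
- by exists (ratr c)%:MP => s; rewrite mevalC.
- by exists (p + q) => s; rewrite mevalD Hp Hq -rmorphD.
- by exists (p * q) => s; rewrite mevalM Hp Hq -rmorphM.
Qed.

(** The determinant condition makes [g] and [h] span all solutions of the recurrence, so l^s and
    l^-s are combinations of them and thereby polynomials in the coordinates. *)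
Lemma torus_class_smooth N (y : nat -> 'I_N -> rat) (K : rat) (g h : nat -> rat) :
  2 < K -> (forall i, seq_alg (lucas K) (fun s => y s i)) ->
  lucas K g -> lucas K h -> g 0%N * h 1%N - g 1%N * h 0%N != 0 ->
  seq_alg (fun f => exists i, forall s, f s = y s i) g ->
  seq_alg (fun f => exists i, forall s, f s = y s i) h ->
  let Z := zariski_closure (range (fun s => \row_i ratr (y s i) : 'rV[C]_N)) in
  zariski_irreducible Z /\ smooth_variety Z.
Proof.
move=> K2 Hy lg lh; set E := (X in X != 0) => E0 Ag Ah Z.
have [l [l0 lK ll linj]] := lucas_root K2.
have /choice [F] : forall i, exists F : (C -> C) * (C -> C),
    laurent F.1 F.2 /\ forall s, ratr (y s i) = F.1 (l ^+ s).
  move=> i; have [F [dF H]] := seq_alg_laurent l0 lK ll (Hy i).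
  by exists (F, dF).
move=> HF; have HF1 i : laurent (F i).1 (F i).2 by case: (HF i).
have vE s i : (\row_i ratr (y s i) : 'rV[C]_N) 0 i = (F i).1 (l ^+ s).
  by rewrite mxE; case: (HF i).
have [p Hp] := seq_alg_mpoly Ag; have [q Hq] := seq_alg_mpoly Ah.
have E0' : ratr E != 0 :> C by rewrite fmorph_eq0.
have rE : ratr E = ratr (g 0%N) * ratr (h 1%N) - ratr (g 1%N) * ratr (h 0%N) :> C.
  by rewrite /E rmorphB !rmorphM.
have lr f : lucas K f -> lucas (ratr K) (fun s => ratr (f s) : C).
  by move=> lf s; rewrite lf rmorphB rmorphM.
have comb (m : C) : m != 0 -> m + m^-1 = ratr K -> exists P : {mpoly C[N]},
    forall s, P.@[(\row_i ratr (y s i) : 'rV[C]_N) 0] = m ^+ s.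
  move=> m0 mK; pose a : C := (ratr (h 1%N) - m * ratr (h 0%N)) / ratr E.
  pose b : C := (ratr (g 0%N) * m - ratr (g 1%N)) / ratr E.
  exists (a%:MP * p + b%:MP * q) => s; rewrite mevalD !mevalM !mevalC Hp Hq.
  apply: (lucas_eq (lucas_lin a b (lr _ lg) (lr _ lh)) (lucas_exp m0 mK));
    rewrite ?expr0 ?expr1 /a /b; move: E0'; rewrite rE => ?; field; done.
have [psi psiE] := comb l l0 lK.
have [||eta etaE] := comb l^-1; [by rewrite invr_eq0 | by rewrite invrK addrC |].
have etaE' s : eta.@[(\row_i ratr (y s i) : 'rV[C]_N) 0] = l ^- s by rewrite etaE exprVn.
split; [apply: (torus_curve_irreducible l0 linj HF1 vE psiE etaE') |
  apply: (torus_curve_smooth l0 linj HF1 vE psiE etaE')].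
Qed.

End Specialization.

(** * The frieze recurrence *)

Section Specializes.
Variables (K : numFieldType) (N : nat) (a : 'rV[K]_N).

Let ev : {mpoly rat[N]} -> K := mmap ratr (a 0).

Let ev_neq0 q : ev q != 0 -> tofrac q != 0 :> ambient N.
Proof. by rewrite tofrac_eq0; apply: contraNneq => ->; rewrite /ev mmap0. Qed.

Lemma specializes_inj g c c' : specializes a g c -> specializes a g c' -> c = c'.
Proof.
move=> [p [q [q0 -> ->]]] [p' [q' [q'0 E ->]]].
have /eqP : p * q' = p' * q.
  apply/eqP; rewrite -tofrac_eq !tofracM; apply/eqP.
  move: (ev_neq0 q0) (ev_neq0 q'0) E => t t' E.
  by rewrite -[tofrac p](divfK t) E mulrAC divfK.
move=> /eqP /(congr1 ev); rewrite /ev !rmorphM /= => H.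
by apply/eqP; rewrite eqr_div // H.
Qed.

Lemma specializes1 : specializes a 1 1.
Proof.
by exists 1, 1; split; rewrite !rmorph1 ?divr1 ?oner_neq0.
Qed.

Lemma specializesM g h c d : specializes a g c -> specializes a h d ->
  specializes a (g * h) (c * d).
Proof.
move=> [p [q [q0 -> ->]]] [p' [q' [q'0 -> ->]]]; exists (p * p'), (q * q').
by split; rewrite !rmorphM /= ?mulf_neq0 // mulf_div.
Qed.

Lemma specializesD g h c d : specializes a g c -> specializes a h d ->
  specializes a (g + h) (c + d).
Proof.
move=> [p [q [q0 -> ->]]] [p' [q' [q'0 -> ->]]]; exists (p * q' + p' * q), (q * q').
by split; rewrite !(rmorphM, rmorphD) /= ?mulf_neq0 // addf_div // ev_neq0.
Qed.

Lemma specializesV g c : c != 0 -> specializes a g c -> specializes a g^-1 c^-1.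
Proof.
move=> c0 [p [q [q0 -> E]]]; exists q, p; rewrite E !invf_div; split=> //.
by apply: contra_neq c0; rewrite E => ->; rewrite mul0r.
Qed.

Lemma specializesX g c n : specializes a g c -> specializes a (g ^+ n) (c ^+ n).
Proof.
by move=> gc; elim: n => [|n IH]; [exact: specializes1 | rewrite !exprS; apply: specializesM].
Qed.

Lemma specializes_prod (I : Type) (r : seq I) (g : I -> ambient N) c :
  (forall i, specializes a (g i) (c i)) ->
  specializes a (\prod_(i <- r) g i) (\prod_(i <- r) c i).
Proof.
move=> gc; elim: r => [|i r IH]; first by rewrite !big_nil; apply: specializes1.
by rewrite !big_cons; apply: specializesM.
Qed.

Lemma specializes_var i : specializes a (initial_variable i) (a 0 i).
Proof.
by exists 'X_i, 1; split; rewrite ?mmapX ?mmap1U !rmorph1 ?divr1 ?oner_neq0.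
Qed.

End Specializes.

(** * Coxeter mutation as successive mutation at sinks *)

Section CoxeterMutation.
Variables (N : nat) (Q : quiver N).
Hypothesis Q_acyclic : forall i j : 'I_N, (i <= j)%N -> Q i j = 0%N.

(* The quiver obtained from [Q] by mutating at the vertices below [k]: each of
   them is a sink when its turn comes. *)
Definition partial_quiver (k : nat) : quiver N :=
  \matrix_(i, j) if (i < k)%N == (j < k)%N then Q i j else Q j i.

Definition partial_mutate (k : nat) (z : 'I_N -> rat) (i : 'I_N) : rat :=
  if i == k :> nat then
    (\prod_j z j ^+ partial_quiver k j i + \prod_j z j ^+ partial_quiver k i j) / z i
  else z i.

Definition frieze_step (y : 'I_N -> rat) : 'I_N -> rat := iteri N partial_mutate y.

Definition frieze_seq (t : nat) : 'I_N -> rat := iter t frieze_step (fun=> 1).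

Lemma partial_quiver0 : partial_quiver 0 = Q.
Proof. by apply/matrixP => i j; rewrite mxE. Qed.

Lemma partial_quiverN : partial_quiver N = Q.
Proof. by apply/matrixP => i j; rewrite mxE !ltn_ord. Qed.

Lemma partial_quiver_sink (k j : 'I_N) :  partial_quiver k k j = 0%N.
Proof.
rewrite mxE ltnn; case: ltnP => [jk|kj] /=.
  by apply: Q_acyclic; apply: ltnW.
exact: Q_acyclic.
Qed.

(** No path passes through a sink, so mutation only reverses its arrows; elsewhere the truncated
    subtraction changes nothing, as an acyclic quiver has no 2-cycles. *)
Lemma mutate_partial_quiver (k : 'I_N) :
  mutate_quiver (partial_quiver k) k = partial_quiver k.+1.
Proof.
apply/matrixP => i j; rewrite mxE.
rewrite !partial_quiver_sink !muln0 !addn0 !mxE !ltnS.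
have [->|ik] /= := eqVneq i k.
  by rewrite ltnn leqnn; case: (ltngtP j k) => [jk|kj|/val_inj ->].
have [->|jk] /= := eqVneq j k.
  by rewrite ltnn leqnn; case: (ltngtP i k) => [//|//|/val_inj ->].
rewrite -!(inj_eq val_inj) /= in ik jk.
rewrite (leq_eqVlt i k) (leq_eqVlt j k) (negbTE ik) (negbTE jk) /=.
rewrite [(j < k)%N == _]eq_sym; case: (_ == _).
  by case: (leqP i j) => [ij|/ltnW ji]; [rewrite (Q_acyclic ij) | rewrite (Q_acyclic ji) subn0].
by case: (leqP i j) => [ij|/ltnW ji]; [rewrite (Q_acyclic ij) subn0 | rewrite (Q_acyclic ji)].
Qed.

Lemma partial_mutate_gt0 k z : (forall i, 0 < z i) -> forall i, 0 < partial_mutate k z i.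
Proof.
move=> z0 i; rewrite /partial_mutate; case: ifP => // _.
by rewrite divr_gt0 // addr_gt0 // prodr_gt0 // => j _; rewrite exprn_gt0.
Qed.

Lemma frieze_step_gt0 y : (forall i, 0 < y i) -> forall i, 0 < frieze_step y i.
Proof.
move=> y0; suff: forall n i, 0 < iteri n partial_mutate y i by apply.
by elim=> [//|n IH] /=; apply: partial_mutate_gt0.
Qed.

Lemma frieze_seq_gt0 t i : 0 < frieze_seq t i.
Proof. by elim: t i => [//|t IH]; apply: frieze_step_gt0. Qed.

Lemma iteri_partial_mutate k y i :
  iteri k partial_mutate y i = if (i < k)%N then iteri i.+1 partial_mutate y i else y i.
Proof.
elim: k => [//|k IH]; rewrite ltnS leq_eqVlt.
have [<-//|ik] /= := eqVneq (i : nat) k.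
by rewrite {1}/partial_mutate (negbTE ik) IH.
Qed.

(** When [i] is mutated, smaller vertices carry their new values and larger ones still the old. All
    arrows at [i] then point to it, so both kinds of neighbours enter one product and the other
    product is 1. *)
Lemma frieze_stepE y i : (forall j, 0 < y j) ->
  frieze_step y i * y i = \prod_j y j ^+ Q j i * \prod_j frieze_step y j ^+ Q i j + 1.
Proof.
move=> y0; rewrite {1}/frieze_step iteri_partial_mutate ltn_ord /=.
rewrite {1}/partial_mutate eqxx iteri_partial_mutate ltnn divfK ?gt_eqF //.
congr (_ + _); last first.
  by apply: big1 => j _; rewrite partial_quiver_sink.
rewrite -big_split; apply: eq_bigr => j _ /=.
rewrite iteri_partial_mutate mxE ltnn /frieze_step [iteri N _ _ j]iteri_partial_mutate ltn_ord.
case: ltnP => [ji|ij] /=; first by rewrite (Q_acyclic (ltnW ji)) expr0 mul1r.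
by rewrite (Q_acyclic ij) expr0 mulr1.
Qed.

Section SpecializeSeeds.
Variables (K : numFieldType) (a : 'rV[K]_N).

Let spec_seed (S : seed N) (k : nat) (z : 'I_N -> rat) : Prop :=
  [/\ seed_quiver S = partial_quiver k, forall i, 0 < z i
    & forall i, specializes a (cluster S i) (ratr (z i))].

(** Positivity is part of [spec_seed] because dividing by a cluster variable is allowed only where
    its value is nonzero. *)
Lemma specializes_mutate S (k : 'I_N) z :
  spec_seed S k z -> spec_seed (mutate S k) k.+1 (partial_mutate k z).
Proof.
move=> [SQ z0 Sz]; split.
- by rewrite /= SQ mutate_partial_quiver.
- exact: partial_mutate_gt0.
move=> i; rewrite /= /partial_mutate -(inj_eq val_inj) /= SQ.
case: ifP => [/eqP /val_inj ->|_]; last exact: Sz.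
rewrite fmorph_div rmorphD /= !rmorph_prod /=.
apply: specializesM; last first.
  by apply: specializesV => //; rewrite fmorph_eq0 gt_eqF.
by apply: specializesD; apply: specializes_prod => j; rewrite rmorphXn /=; apply: specializesX.
Qed.

Lemma specializes_mu_c S y : spec_seed S 0 y -> spec_seed (mu_c S) 0 (frieze_step y).
Proof.
move=> SS; suff: forall k, (k <= N)%N ->
    spec_seed (foldl (@mutate N) S (take k (enum 'I_N))) k (iteri k partial_mutate y).
  move=> /(_ N (leqnn N)); rewrite take_oversize ?size_enum_ord //.
  by case=> H1 H2 H3; split=> //; rewrite H1 partial_quiverN partial_quiver0.
elim=> [_|k IH kN]; first by rewrite take0.
have -> : take k.+1 (enum 'I_N) = rcons (take k (enum 'I_N)) (Ordinal kN).
  rewrite (take_nth (Ordinal kN)) ?size_enum_ord //; congr rcons.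
  by apply: val_inj; rewrite /= nth_enum_ord.
by rewrite foldl_rcons; apply: (@specializes_mutate _ (Ordinal kN)); apply: IH; apply: ltnW.
Qed.

End SpecializeSeeds.

Lemma frieze_varietyE (K : numFieldType) (fc : {rmorphism ambient N -> ambient N}) :
  coxeter_automorphism Q fc ->
  frieze_variety fc (const_mx 1 : 'rV[K]_N) =
  zariski_closure (range (fun t => \row_i ratr (frieze_seq t i) : 'rV[K]_N)).
Proof.
move=> [_ fcE]; rewrite /frieze_variety; congr zariski_closure.
have spec t i : specializes (const_mx 1 : 'rV[K]_N) (iter t fc (initial_variable i))
    (ratr (frieze_seq t i)).
  rewrite fcE; move: i.
  suff: [/\ seed_quiver (iter t (@mu_c N) (initial_seed Q)) = partial_quiver 0,
    forall i, 0 < frieze_seq t i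
    & forall i, specializes (const_mx 1 : 'rV[K]_N)
        (cluster (iter t (@mu_c N) (initial_seed Q)) i) (ratr (frieze_seq t i))] by case.
  elim: t => [|t IH]; last exact: specializes_mu_c.
  split=> //= [|i]; first by rewrite partial_quiver0.
  have := specializes_var (const_mx 1 : 'rV[K]_N) i; by rewrite mxE rmorph1.
apply/seteqP; split=> x [t].
  move=> H; exists t => //; apply/rowP => i; rewrite mxE.
  exact: specializes_inj (spec t i) (H i).
by move=> _ <-; exists t => i; rewrite mxE.
Qed.

End CoxeterMutation.

(** * Friezes indexed by vertex labels *)

Section LabelledFrieze.
Variables (N : nat) (s : seq (nat * nat)).
Hypothesis s_range : all (fun ab => (0 < ab.2 < ab.1)%N && (ab.1 <= N)%N) s.

(** The default 1 keeps all values positive, and equal to 1 at time 0, off the quiver too. Labels 0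
    and 1 are read alike. *)
Definition labelled (y : 'I_N -> rat) (l : nat) : rat :=
  if insub l.-1 is Some i then y i else 1.

Lemma labelledE y (i : 'I_N) : labelled y i.+1 = y i.
Proof. by rewrite /labelled /= valK. Qed.

Let prod_delta (y : 'I_N -> rat) (l : nat) (b : bool) : (0 < l <= N)%N ->
  \prod_(j < N) y j ^+ (b && (l == j.+1)) = if b then labelled y l else 1.
Proof.
case: l => // l /= lN; case: b; last by apply: big1.
rewrite (bigD1 (Ordinal lN)) //= eqxx expr1 big1 ?mulr1.
  by rewrite -(labelledE y (Ordinal lN)).
by move=> j jl; rewrite eqSS -[l]/(val (Ordinal lN)) (inj_eq val_inj) eq_sym (negbTE jl).
Qed.

Lemma prod_arrows_in y (i : 'I_N) :
  \prod_j y j ^+ quiver_of_arrows N s j i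
  = \prod_(ab <- s | ab.2 == i.+1) labelled y ab.1.
Proof.
elim: s s_range => [_|[a b] s' IH] /=.
  by rewrite big_nil; apply: big1 => j _; rewrite mxE.
move=> /andP [/andP [/andP [b0 ba] aN] Hs]; rewrite big_cons /= -IH //.
under eq_bigr => j _ do rewrite mxE /= exprD xpair_eqE andbC.
rewrite big_split /= prod_delta ?aN ?(ltn_trans b0 ba) //.
under [X in _ * X]eq_bigr => j _ do
  rewrite -[count_mem _ _](mxE matrix_key (fun j i => count_mem (j.+1, i.+1) s')).
by case: ifP => _; rewrite ?mul1r.
Qed.

Lemma prod_arrows_out y (i : 'I_N) :
  \prod_j y j ^+ quiver_of_arrows N s i j
  = \prod_(ab <- s | ab.1 == i.+1) labelled y ab.2.
Proof.
elim: s s_range => [_|[a b] s' IH] /=.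
  by rewrite big_nil; apply: big1 => j _; rewrite mxE.
move=> /andP [/andP [/andP [b0 ba] aN] Hs]; rewrite big_cons /= -IH //.
under eq_bigr => j _ do rewrite mxE /= exprD xpair_eqE.
rewrite big_split /= prod_delta ?b0 ?(leq_trans (ltnW ba) aN) //.
under [X in _ * X]eq_bigr => j _ do
  rewrite -[count_mem _ _](mxE matrix_key (fun i j => count_mem (i.+1, j.+1) s')).
by case: ifP => _; rewrite ?mul1r.
Qed.

Lemma quiver_of_arrows_acyclic (i j : 'I_N) :
  (i <= j)%N -> quiver_of_arrows N s i j = 0%N.
Proof.
move=> ij; rewrite mxE; apply/count_memPn/negP => /(allP s_range) /=.
by rewrite ltnS ltnNge ij.
Qed.

End LabelledFrieze.

Record frieze (N : nat) (s : seq (nat * nat)) (Y : nat -> nat -> rat) : Prop := Frieze {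
  frieze0 : forall l, Y 0%N l = 1;
  frieze_gt0 : forall t l, 0 < Y t l;
  friezeS : forall t l, (0 < l <= N)%N ->
    Y t.+1 l * Y t l = \prod_(ab <- s | ab.2 == l) Y t ab.1
                       * \prod_(ab <- s | ab.1 == l) Y t.+1 ab.2 + 1 }.

(* On each residue class of the time modulo [m], the frieze is a curve
   parametrized by the torus: [lucas K] sequences are the combinations of the
   powers of [z] and [1/z], where z + 1/z = K. *)
Definition torus_periodic (N : nat) (Y : nat -> nat -> rat) : Prop :=
  exists (m : nat) (K : rat), [/\ (0 < m)%N, 2 < K & forall r, (r < m)%N ->
    (forall l, (0 < l <= N)%N -> seq_alg (lucas K) (fun s => Y (r + m * s)%N l)) /\
    exists g h : nat -> rat, [/\ lucas K g, lucas K h,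
      g 0%N * h 1%N - g 1%N * h 0%N != 0
      & forall f, f = g \/ f = h ->
        seq_alg (fun f => exists2 l, (0 < l <= N)%N & forall s, f s = Y (r + m * s)%N l) f]].

Lemma seq_alg_mono (R : comNzRingType) (S S' : (nat -> R) -> Prop) f :
  (forall g, S g -> S' g) -> seq_alg S f -> seq_alg S' f.
Proof.
move=> SS'; elim=> [g /SS'|c|g h _ Ag _ Ah|g h _ Ag _ Ah].
- exact: seq_alg_gen.
- exact: seq_alg_cst.
- exact: seq_algD.
- exact: seq_algM.
Qed.

Lemma torus_periodic_component_smooth (R : realType) (N : nat) (s : seq (nat * nat))
    (fc : {rmorphism ambient N -> ambient N}) (Y : set 'rV[R[i]]_N) :
  all (fun ab => (0 < ab.2 < ab.1)%N && (ab.1 <= N)%N) s ->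
  (forall y, frieze N s y -> torus_periodic N y) ->
  coxeter_automorphism (quiver_of_arrows N s) fc ->
  irreducible_component (frieze_variety fc (const_mx 1 : 'rV[R[i]]_N)) Y ->
  smooth_variety Y.
Proof.
move=> s_range per hfc; set Q := quiver_of_arrows N s in hfc *.
have Q0 : forall i j : 'I_N, (i <= j)%N -> Q i j = 0%N := quiver_of_arrows_acyclic s_range.
rewrite (frieze_varietyE Q0 _ hfc) => hY.
pose y t l := labelled (frieze_seq Q t) l.
have yE t (i : 'I_N) : frieze_seq Q t i = y t i.+1 by rewrite /y labelledE.
have [|m [K [m0 K2 Hm]]] := per y.
  split=> [l|t l|t [//|l] /= lN].
  - by rewrite /y /labelled; case: insub.
  - by rewrite /y /labelled; case: insub => // i; apply: frieze_seq_gt0.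
  have := frieze_stepE Q0 (Ordinal lN) (fun j => frieze_seq_gt0 Q t j).
  rewrite prod_arrows_in // prod_arrows_out //= -[frieze_step _ _]/(frieze_seq Q t.+1) => <-.
  by rewrite !yE.
pose v t : 'rV[R[i]]_N := \row_i ratr (frieze_seq Q t i).
have cls r : (r < m)%N ->
    zariski_irreducible (zariski_closure (range (fun s => v (r + m * s)%N))) /\
    smooth_variety (zariski_closure (range (fun s => v (r + m * s)%N))).
  move=> /Hm [HY [g [h [lg lh gh Agh]]]].
  have coord f : f = g \/ f = h ->
      seq_alg (fun f => exists i, forall s, f s = frieze_seq Q (r + m * s) i) f.
    move=> /Agh; apply: seq_alg_mono => f' [[//|l] lN fE].
    by exists (Ordinal lN) => u; rewrite fE yE.
  refine (@torus_class_smooth R N (fun u i => frieze_seq Q (r + m * u) i) K g h K2 _ lg lh gh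
    (coord _ (or_introl erefl)) (coord _ (or_intror erefl))) => i.
  by apply: seq_alg_ext (HY i.+1 (ltn_ord i)) _ => u; rewrite yE.
have [||r rm ->] := @irreducible_component_closure_periodic _ _ v m Y m0.
- by move=> r rm; case: (cls r rm).
- exact: hY.
- by case: (cls r rm).
Qed.

(** * Types E6, E7, E8 *)

Delimit Scope Z_scope with BZ.

Section IntegerPolynomials.

Fixpoint zadd (p q : seq Z) : seq Z :=
  match p, q with
  | [::], _ => q
  | _, [::] => p
  | a :: p', b :: q' => Z.add a b :: zadd p' q'
  end.

Definition zscale (c : Z) (p : seq Z) : seq Z := map (Z.mul c) p.

Fixpoint zmul (p q : seq Z) : seq Z :=
  if p is a :: p' then zadd (zscale a q) (0%BZ :: zmul p' q) else [::].

Definition zprod (ps : seq (seq Z)) : seq Z := foldr zmul [:: 1%BZ] ps.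

(* Power series division, used only to find the next row of a table. *)
Fixpoint zdiv (n : nat) (p q : seq Z) : seq Z :=
  if n is n'.+1 then
    let c := Z.div (head 0%BZ p) (head 0%BZ q) in
    c :: zdiv n' (behead (zadd p (zscale (Z.opp c) q))) q
  else [::].

(** The step from s to s + 1 replaces x = U/V by 1/(K - x) and V by V (K - x). A form V^d p(x) of
    degree d thus becomes V^d times the reversed polynomial at K - x, computed here by Horner's
    rule. *)
Definition zcomp_sub (K : Z) (p : seq Z) : seq Z :=
  foldr (fun a r => zadd [:: a] (zmul r [:: K; (-1)%BZ])) [::] (rev p).

End IntegerPolynomials.

Section Tables.
Variables (N : nat) (s : seq (nat * nat)) (K : Z) (m : nat) (delta : seq nat).

(* With U_0 = 0, U_1 = 1, U_(s+2) = K U_(s+1) - U_s and V_s = U_(s+1), row r of the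
   table claims that y_(r + m s) at the label l is V_s^d p(U_s / V_s), where p is
   the entry and d = delta_l is the coefficient of l in the null root.  The constant 1
   of the exchange relation is made homogeneous by U^2 - K U V + V^2 = 1. *)
Definition entry (row : seq (seq Z)) (l : nat) : seq Z := nth [::] row l.-1.

Definition zconic : seq Z := [:: 1%BZ; Z.opp K; 1%BZ].

Definition exchange_rhs (old new : seq (seq Z)) (l : nat) : seq Z :=
  zadd (zmul (zprod [seq entry old ab.1 | ab <- s & ab.2 == l])
             (zprod [seq entry new ab.2 | ab <- s & ab.1 == l]))
       (zprod (nseq (nth 0%N delta l.-1) zconic)).

Definition next_row (row : seq (seq Z)) : seq (seq Z) :=
  foldl (fun new l => rcons new
           (zdiv (nth 0%N delta l.-1).+1 (exchange_rhs row new l) (entry row l)))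
        [::] (iota 1 N).

Definition exchange_check (old new : seq (seq Z)) : bool :=
  all (fun l => zmul (entry new l) (entry old l) == exchange_rhs old new l) (iota 1 N).

Definition row_check (row : seq (seq Z)) : bool :=
  all (fun l => size (entry row l) == (nth 0%N delta l.-1).+1) (iota 1 N).

(** The additivity of the null root makes both sides of the exchange relation at [l] homogeneous of
    degree 2 delta_l in U and V. *)
Definition degree_check : bool :=
  all (fun l => (nth 0%N delta l.-1).*2 ==
     sumn [seq nth 0%N delta ab.1.-1 | ab <- s & ab.2 == l]
     + sumn [seq nth 0%N delta ab.2.-1 | ab <- s & ab.1 == l])%N (iota 1 N).

(** The entries at vertex 1 are linear forms q V + p U. The conditions are independence of the first
    two rows, independence of the first and third, and a nonzero coefficient of the square of the
    second form in the conic rewritten in the first two. *)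
Definition det_check (r0 r1 r2 : seq (seq Z)) : bool :=
  match entry r0 1, entry r1 1, entry r2 1 with
  | [:: q0; p0], [:: q1; p1], [:: q2; p2] =>
    [&& Z.sub (Z.mul q0 p1) (Z.mul q1 p0) != 0%BZ,
        Z.sub (Z.mul q0 p2) (Z.mul q2 p0) != 0%BZ
      & Z.add (Z.add (Z.mul q0 q0) (Z.mul K (Z.mul q0 p0))) (Z.mul p0 p0) != 0%BZ]
  | _, _, _ => false
  end.

Definition table (row0 : seq (seq Z)) : seq (seq (seq Z)) := traject next_row row0 m.+3.

(** A finite certificate for all times: values 1 at U = 0, V = 1, exchange relations between
    consecutive rows as polynomial identities, and row [m] equal to row 0 advanced by one in s,
    which closes the induction. The table runs past [m] because [det_check] looks two rows ahead. *)
Definition table_check (row0 : seq (seq Z)) : bool :=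
  let T := table row0 in
  let row := nth [::] T in
  [&& degree_check,
      all (fun p => head 0%BZ p == 1%BZ) row0 && (size row0 == N),
      all row_check T,
      all (fun r => exchange_check (row r) (row r.+1)) (iota 0 m.+2),
      row m == map (zcomp_sub K) row0
    & all (fun r => det_check (row r) (row r.+1) (row r.+2)) (iota 0 m)].

End Tables.

Lemma seq_alg_exp (R : comNzRingType) (S : (nat -> R) -> Prop) f n :
  seq_alg S f -> seq_alg S (fun s => f s ^+ n).
Proof.
move=> Sf; elim: n => [|n IH]; first exact: seq_alg_cst.
by apply: seq_alg_ext (seq_algM Sf IH) _ => s; rewrite exprS.
Qed.

(** * Evaluating the tables on the conic *)

Section Evaluation.

Definition zr (z : Z) : rat := (int_of_Z z)%:~R.

Lemma zrD a b : zr (Z.add a b) = zr a + zr b.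
Proof. by rewrite /zr (rmorphD int_of_Z) intrD. Qed.

Lemma zrM a b : zr (Z.mul a b) = zr a * zr b.
Proof. by rewrite /zr (rmorphM int_of_Z) intrM. Qed.

Lemma zrN a : zr (Z.opp a) = - zr a.
Proof. by rewrite /zr (rmorphN int_of_Z) intrN. Qed.

Lemma zrB a b : zr (Z.sub a b) = zr a - zr b.
Proof. by rewrite /zr (rmorphB int_of_Z) intrB. Qed.

Lemma zr_eq0 a : (zr a == 0) = (a == 0%BZ).
Proof. by rewrite /zr intr_eq0 -(rmorph0 int_of_Z) (inj_eq (can_inj int_of_ZK)). Qed.

Definition zeval (p : seq Z) (x : rat) : rat := foldr (fun a r => zr a + x * r) 0 p.

Lemma zeval_add p q x : zeval (zadd p q) x = zeval p x + zeval q x.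
Proof.
elim: p q => [|a p IH] [|b q] /=; rewrite ?add0r ?addr0 //.
by rewrite zrD IH; ring.
Qed.

Lemma zeval_mul p q x : zeval (zmul p q) x = zeval p x * zeval q x.
Proof.
elim: p => [|a p IH] /=; first by rewrite mul0r.
have zsc : zeval (zscale a q) x = zr a * zeval q x.
  by elim: q {IH} => [|b q IH] /=; rewrite ?mulr0 // zrM IH; ring.
by rewrite zeval_add zsc /= IH; ring.
Qed.

Lemma zeval_prod ps x : zeval (zprod ps) x = \prod_(p <- ps) zeval p x.
Proof.
elim: ps => [|p ps IH]; first by rewrite big_nil /= mulr0 addr0.
by rewrite big_cons /= zeval_mul IH.
Qed.

Lemma zeval_rcons p a x : zeval (rcons p a) x = zeval p x + zr a * x ^+ size p.
Proof.
elim: p => [|b p IH] /=; first by rewrite expr0; ring.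
by rewrite IH exprS; ring.
Qed.

Lemma zeval_rev p x : x != 0 -> zeval (rev p) x * x = x ^+ size p * zeval p x^-1.
Proof.
move=> x0; elim: p => [|a p IH] /=; first by rewrite mul0r mulr0.
rewrite rev_cons zeval_rcons size_rev exprS mulrDl IH; field.
exact: x0.
Qed.

Lemma zeval_comp_sub K p x : zeval (zcomp_sub K p) x = zeval (rev p) (zr K - x).
Proof.
rewrite /zcomp_sub; set f := (f in foldr f); elim: (rev p) => [//|a q IH].
rewrite -[foldr f _ _]/(zadd [:: a] (zmul (foldr f [::] q) [:: K; (-1)%BZ])).
by rewrite zeval_add zeval_mul IH /= (_ : zr (-1) = -1) //; ring.
Qed.

End Evaluation.

Section Conic.
Variable K : rat.
Hypothesis K_gt2 : 2 < K.

Definition conic_seq (s : nat) : rat * rat := iter s (fun uv => (uv.2, K * uv.2 - uv.1)) (0, 1).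

Let U s := (conic_seq s).1.
Let V s := (conic_seq s).2.

Lemma conic_seq_bound s : 0 <= U s < V s.
Proof.
have K2 := K_gt2; elim: s => [//|s IH]; rewrite -[U s.+1]/(V s) -[V s.+1]/(K * V s - U s).
have step (u v : rat) : 0 <= u < v -> 0 <= v < K * v - u; last exact: step.
move=> /andP [u0 uv]; have : 0 < (K - 2) * v by apply: mulr_gt0; lra.
by rewrite mulrBl => H; apply/andP; split; lra.
Qed.

Lemma conic_seqV_gt0 s : 0 < V s.
Proof. by have /andP [] := conic_seq_bound s; apply: le_lt_trans. Qed.

Lemma conic_seqE s : U s ^+ 2 - K * (U s * V s) + V s ^+ 2 = 1.
Proof.
elim: s => [|s IH]; first by rewrite /U /V /=; ring.
rewrite -[U s.+1]/(V s) -[V s.+1]/(K * V s - U s) -[RHS]IH; ring.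
Qed.

Lemma seq_alg_form d p : (size p <= d.+1)%N ->
  seq_alg (lucas K) (fun s => V s ^+ d * zeval p (U s / V s)).
Proof.
have V0 s : V s != 0 by rewrite gt_eqF // conic_seqV_gt0.
have AV : seq_alg (lucas K) V by apply: seq_alg_gen.
have AU : seq_alg (lucas K) U by apply: seq_alg_gen.
elim: p d => [|a [|b p] IH] [|d] // sp.
- by apply: seq_alg_ext (seq_alg_cst _ 0) _ => s; rewrite mulr0.
- by apply: seq_alg_ext (seq_alg_cst _ 0) _ => s; rewrite mulr0.
- by apply: seq_alg_ext (seq_alg_cst _ (zr a)) _ => s; rewrite /= mulr0 addr0 mul1r.
- apply: seq_alg_ext (seq_algZ (zr a) (seq_alg_exp d.+1 AV)) _ => s.
  by rewrite /= mulr0 addr0 mulrC.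
- have := seq_algD (seq_algZ (zr a) (seq_alg_exp d.+1 AV)) (seq_algM AU (IH d sp)).
  move=> H; apply: seq_alg_ext H _ => s.
  rewrite -[zeval (a :: _) _]/(zr a + U s / V s * zeval (b :: p) (U s / V s)) exprS.
  by move: (zeval _ _) => e; field; apply: V0.
Qed.

End Conic.

Section TableCorrect.
Variables (N : nat) (s : seq (nat * nat)) (k : Z) (m : nat) (delta : seq nat).
Variables (row0 : seq (seq Z)) (j3 : nat) (y : nat -> nat -> rat).
Hypothesis s_range : all (fun ab => (0 < ab.2 < ab.1)%N && (ab.1 <= N)%N) s.
Hypothesis check : table_check N s k m delta row0.
Hypothesis k_gt2 : 2 < zr k.
Hypothesis fy : frieze N s y.

Let d l := nth 0%N delta l.-1.
Let U t := (conic_seq (zr k) t).1.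
Let V t := (conic_seq (zr k) t).2.
Let x t := U t / V t.
Let row := nth [::] (table N s k m delta row0).
Let V_neq0 t : V t != 0. Proof. by rewrite gt_eqF // conic_seqV_gt0. Qed.

Let row_valid (r t : nat) : Prop := forall l, (0 < l <= N)%N ->
  y (r + m * t)%N l = V t ^+ d l * zeval (entry (row r) l) (x t).

Let in_iota l : (0 < l <= N)%N -> l \in iota 1 N.
Proof. by rewrite mem_iota add1n ltnS. Qed.

Let prod_pow (c : rat) (J : seq (nat * nat)) (P : pred (nat * nat)) (f : nat * nat -> nat)
    (Y : nat -> rat) (E : nat -> rat) :
  (forall ab, ab \in J -> P ab -> Y (f ab) = c ^+ d (f ab) * E (f ab)) ->
  \prod_(ab <- J | P ab) Y (f ab)
  = c ^+ sumn [seq d (f ab) | ab <- J & P ab] * \prod_(ab <- J | P ab) E (f ab).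
Proof.
move=> H; rewrite sumnE big_map big_filter -prodrXr -big_split /=.
by rewrite !(big_seq_cond P); apply: eq_bigr => ab /andP [abJ Pab]; apply: H.
Qed.

(** Arrows decrease labels, so the new value at [l] involves new values at smaller labels only;
    hence the induction on [l] inside a single time step. *)
Lemma row_validS r t : (r < m.+2)%N -> row_valid r t -> row_valid r.+1 t.
Proof.
move=> rm Hr.
have /and5P [/allP dc _ _ /allP xc _] := check.
have /xc /allP {}xc : r \in iota 0 m.+2 by rewrite mem_iota.
elim/ltn_ind => l IH lN.
have /eqP E := xc l (in_iota lN); have /eqP dE := dc l (in_iota lN).
have yl0 : y (r + m * t)%N l != 0 by rewrite gt_eqF // (frieze_gt0 fy).
rewrite addSn; apply: (mulIf yl0); rewrite (friezeS fy) //.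
rewrite [in RHS]Hr //.
have -> : V t ^+ d l * zeval (entry (row r.+1) l) (x t)
     * (V t ^+ d l * zeval (entry (row r) l) (x t))
   = V t ^+ (d l).*2 * zeval (zmul (entry (row r.+1) l) (entry (row r) l)) (x t).
  by rewrite zeval_mul -addnn exprD; ring.
rewrite E /exchange_rhs zeval_add zeval_mul !zeval_prod !big_map !big_filter mulrDr.
congr (_ + _).
  rewrite (prod_pow (c := V t) (E := fun l => zeval (entry (row r) l) (x t))); last first.
    move=> ab abs _; apply: Hr; have /andP [] := allP s_range _ abs.
    by move=> /andP [b0 ba] ->; rewrite (ltn_trans b0 ba).
  rewrite (prod_pow (c := V t) (E := fun l => zeval (entry (row r.+1) l) (x t))); last first.
    move=> ab abs /eqP El; have /andP [/andP [b0 ba] aN] := allP s_range _ abs.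
    rewrite -addSn IH ?b0 ?(leq_trans (ltnW ba) aN) //; first by rewrite -El.
  rewrite /d dE exprD; ring.
have q1 : V t ^+ 2 * zeval (zconic k) (x t) = 1.
  rewrite -(conic_seqE (zr k) t) -/(U t) -/(V t) /zconic /= zrN /x (_ : zr 1 = 1) //.
  by field; apply: V_neq0.
rewrite /d; elim: (nth 0%N delta l.-1) => [|n IHn]; first by rewrite expr0 big_nil mul1r.
by rewrite doubleS -[n.*2.+2]/(2 + n.*2)%N exprD /= big_cons mulrACA q1 mul1r.
Qed.

Let entry0_size l : (0 < l <= N)%N -> size (entry row0 l) = (d l).+1.
Proof.
move=> lN; have /and5P [_ _ rc _ _] := check; have /andP [/allP rc0 _] := rc.
exact/eqP/rc0/in_iota.
Qed.

Lemma row_valid0 : row_valid 0 0.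
Proof.
have /and5P [_ /andP [/allP h0 /eqP sz] _ _ _] := check.
move=> l lN; rewrite muln0 (frieze0 fy) -[V 0]/1 expr1n mul1r -[row 0]/row0.
have lN' : (l.-1 < size row0)%N by rewrite sz; case: (l) lN.
have /eqP hd := h0 _ (mem_nth [::] lN').
rewrite /x -[U 0]/0 mul0r /entry; case: (nth _ _ _) hd => [//|a p] /= ->.
by rewrite mul0r addr0.
Qed.

Lemma row_valid_shift t : row_valid m t -> row_valid 0 t.+1.
Proof.
have /and5P [_ /andP [_ /eqP sz] _ _ /andP [/eqP rm _]] := check.
move=> Hm l lN; rewrite add0n mulnS Hm // -[row 0]/row0 [row m]rm /entry.
have lN' : (l.-1 < size row0)%N by rewrite sz; case: (l) lN.
rewrite (nth_map [::]) // zeval_comp_sub -/(entry row0 l).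
have -> : zr k - x t = V t.+1 / V t.
  rewrite -[V t.+1]/(zr k * V t - U t) /x; field; exact: V_neq0.
have -> : x t.+1 = (V t.+1 / V t)^-1 by rewrite invf_div.
have X0 : V t.+1 / V t != 0 by rewrite mulf_neq0 ?invr_eq0.
apply: (mulIf X0); rewrite -mulrA zeval_rev // entry0_size // exprS.
rewrite expr_div_n; move: (zeval _ _) (expf_neq0 (d l) (V_neq0 t)) => e.
move: (V t ^+ d l) (V t.+1 ^+ d l) (V t.+1 / V t) => b b' X b0.
by field.
Qed.

Lemma row_valid_all r t : (r < m.+3)%N -> row_valid r t.
Proof.
have step u : row_valid 0 u -> forall r, (r < m.+3)%N -> row_valid r u.
  by move=> H; elim=> [//|n IH] nm; apply: row_validS => //; apply: IH; apply: ltnW.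
elim: t r => [|t IH] r rm; first by apply: step => //; apply: row_valid0.
by apply: step => //; apply: row_valid_shift; apply: IH; rewrite ltnS leqW.
Qed.

Hypothesis in1 : [seq ab.1 | ab <- s & ab.2 == 1%N] = [:: 2%N].
Hypothesis out1 : [seq ab.2 | ab <- s & ab.1 == 1%N] = [::].
Hypothesis in2 : [seq ab.1 | ab <- s & ab.2 == 2%N] = [:: j3].
Hypothesis out2 : [seq ab.2 | ab <- s & ab.1 == 2%N] = [:: 1%N].
Hypothesis m_gt0 : (0 < m)%N.
Hypothesis N_ge2 : (2 <= N)%N.
Hypothesis j3N : (0 < j3 <= N)%N.
Hypothesis d1 : d 1 = 1%N.

Let prod_in t l : \prod_(ab <- s | ab.2 == l) y t ab.1
  = \prod_(a <- [seq ab.1 | ab <- s & ab.2 == l]) y t a.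
Proof. by rewrite big_map big_filter. Qed.

Let prod_out t l : \prod_(ab <- s | ab.1 == l) y t ab.2
  = \prod_(a <- [seq ab.2 | ab <- s & ab.1 == l]) y t a.
Proof. by rewrite big_map big_filter. Qed.

Let y2E t : y t 2 = y t 1 * y t.+1 1 - 1.
Proof.
have := friezeS fy t (l := 1%N); rewrite (ltnW N_ge2) => /(_ isT).
by rewrite prod_in prod_out in1 out1 big_seq1 big_nil => H; rewrite mulrC H; ring.
Qed.

(** The third continuant of consecutive values at vertex 1, obtained by walking up the arm 1 <- 2 <-
    [j3] and dividing by a positive value. *)
Let y3E t : y t j3 = y t 1 * y t.+1 1 * y t.+2 1 - y t.+2 1 - y t 1.
Proof.
have := friezeS fy t (l := 2%N); rewrite N_ge2 => /(_ isT).
rewrite prod_in prod_out in2 out2 !big_seq1 !y2E => H.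
have n0 : y t.+1 1 != 0 by rewrite gt_eqF // (frieze_gt0 fy).
apply: (mulIf n0); rewrite -[LHS](addrK 1) -H; ring.
Qed.

(* Put w_j = y(t+j, 1).  As w_0, w_1 are independent, w_2 = a w_0 + b w_1 with
   b <> 0, and the conic is A w_0^2 + B w_0 w_1 + C w_1^2 = 1.  Since w_0 w_1 and
   w_2 (w_0 w_1 - 1) are polynomials in the coordinates, so is w_1. *)
Lemma table_torus_periodic : torus_periodic N y.
Proof.
exists m, (zr k); split=> // r rm.
have valid j t : (j < 3)%N -> row_valid (r + j) t.
  by move=> j_lt3; apply: row_valid_all; lia.
split.
  move=> l lN; have := @seq_alg_form _ k_gt2 (d l) (entry (row r) l).
  have /and5P [_ _ /allP rc _ _] := check.
  have /rc /allP /(_ l (in_iota lN)) /eqP -> : row r \in table N s k m delta row0.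
    by apply: mem_nth; rewrite size_traject; lia.
  move=> /(_ (leqnn _)) H; apply: seq_alg_ext H _ => t.
  by have := valid 0%N t isT l lN; rewrite addn0.
have /and5P [_ _ _ _ /andP [_ /allP dc]] := check.
have /dc : r \in iota 0 m by rewrite mem_iota.
pose w j t := y (r + j + m * t)%N 1%N.
have wE j q p : entry (row (r + j)) 1 = [:: q; p] -> (j < 3)%N ->
    w j =1 (fun t => zr q * V t + zr p * U t).
  move=> E jr t; rewrite /w valid // ?d1 ?E /=; last by rewrite (ltnW N_ge2).
  by rewrite /x; field; apply: V_neq0.
have wS j t : w j t = y (j + (r + m * t))%N 1%N by rewrite /w addnAC addnC.
move: (wE 0%N) (wE 1%N) (wE 2%N); rewrite addn0 addn1 addn2.
rewrite /det_check -/(row _) -/(row _) -/(row _).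
case: (entry (row r) 1) => [|q0 [|p0 [|? ?]]] //.
case: (entry (row r.+1) 1) => [|q1 [|p1 [|? ?]]] //.
case: (entry (row r.+2) 1) => [|q2 [|p2 [|? ?]]] //.
move=> /(_ _ _ erefl isT) w0E /(_ _ _ erefl isT) w1E /(_ _ _ erefl isT) w2E.
rewrite -!zr_eq0 !(zrB, zrD, zrM) => /and3P [D01 D02 C0].
have lw j q p : w j =1 (fun t => zr q * V t + zr p * U t) -> lucas (zr k) (w j).
  by move=> E t; rewrite !E; apply: lucas_lin.
pose S (f : nat -> rat) :=
  exists2 l, (0 < l <= N)%N & forall t, f t = y (r + m * t)%N l.
have Aw0 : seq_alg S (w 0%N).
  by apply: seq_alg_gen; exists 1%N; rewrite ?(ltnW N_ge2) // => t; rewrite /w addn0.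
have Ay2 : seq_alg S (fun t => y (r + m * t)%N 2%N).
  by apply: seq_alg_gen; exists 2%N; rewrite ?N_ge2.
have Ay3 : seq_alg S (fun t => y (r + m * t)%N j3).
  by apply: seq_alg_gen; exists j3.
exists (w 0%N), (w 1%N); split.
- exact: lw w0E.
- exact: lw w1E.
- rewrite !w0E !w1E; apply: contra_neq D01.
  by rewrite /U /V /= => H; rewrite -[RHS]H; ring.
move=> f [->//|->].
(* [A], [B], [C] are the coefficients of the conic in w_0 and w_1, scaled by [D ^+ 2]; the three
   determinants are the 2 x 2 minors of the linear forms. *)
pose A := zr q1 * zr q1 + zr k * (zr q1 * zr p1) + zr p1 * zr p1.
pose B := - (zr q0 * zr q1 + zr k * (zr q0 * zr p1 + zr q1 * zr p0) + zr p0 * zr p1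
   + zr q0 * zr q1 + zr p0 * zr p1).
pose C := zr q0 * zr q0 + zr k * (zr q0 * zr p0) + zr p0 * zr p0.
pose D := zr q0 * zr p1 - zr q1 * zr p0.
pose D2 := zr q0 * zr p2 - zr q2 * zr p0.
pose D12 := zr q1 * zr p2 - zr q2 * zr p1.
pose P t := y (r + m * t)%N 2%N + 1.
have AP : seq_alg S P by apply: seq_algD => //; apply: seq_alg_cst.
pose T t := y (r + m * t)%N j3 + w 0%N t.
have AT : seq_alg S T by apply: seq_algD.
(* Multiply the conic by w_0 and eliminate w_0 w_1^2 against w_2 (w_0 w_1 - 1): what remains is C *
   D2 * w_1. *)
have AX : seq_alg S (fun t => D2 * (D ^+ 2 * w 0%N t - A * w 0%N t ^+ 3 - B * (P t * w 0%N t))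
    - C * (D * T t + D12 * (w 0%N t * P t - w 0%N t))).
  apply: seq_algB; apply: seq_algZ.
    apply: seq_algB; last by apply: seq_algZ; apply: seq_algM.
    by apply: seq_algB; apply: seq_algZ => //; apply: seq_alg_exp.
  apply: seq_algD; apply: seq_algZ => //.
  by apply: seq_algB => //; apply: seq_algM.
apply: seq_alg_ext (seq_algZ (C * D2)^-1 AX) _ => t.
have CD : C * D2 != 0 by rewrite mulf_neq0.
apply: (mulfI CD); rewrite mulVKf //.
have PE : P t = w 0%N t * w 1%N t by rewrite /P y2E !wS !addSn !add0n subrK.
have TE : T t = w 0%N t * w 1%N t * w 2 t - w 2 t.
  by rewrite /T y3E !wS !addSn !add0n subrK.
have conic := conic_seqE (zr k) t; rewrite -/(U t) -/(V t) in conic.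
have cE : A * w 0%N t ^+ 2 + B * (w 0%N t * w 1%N t) + C * w 1%N t ^+ 2 = D ^+ 2.
  rewrite -[RHS]mulr1 -conic w0E w1E /A /B /C /D; ring.
have pE : D * w 2 t = D2 * w 1%N t - D12 * w 0%N t.
  rewrite w0E w1E w2E /D /D2 /D12; ring.
rewrite PE TE -cE; move: (w 0%N t) (w 1%N t) (w 2 t) pE => u0 u1 u2 pE.
have -> : D * (u0 * u1 * u2 - u2) = (D * u2) * (u0 * u1 - 1) by ring.
rewrite pE; ring.
Qed.

End TableCorrect.

(* The first rows were found by interpolating the computed values of y_(m s). *)
Definition E6_row0 : seq (seq Z) := [::
 [:: 1; -5]; [:: 1; -7; 19]; [:: 1; -5]; [:: 1; -7; 19]; [:: 1; -5]; [:: 1; -7; 19];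
 [:: 1; -3; 9; -14]]%BZ.

Definition E7_row0 : seq (seq Z) := [::
 [:: 1; -48]; [:: 1; -78; 2063]; [:: 1; -80; 3771; -68031];
 [:: 1; -48]; [:: 1; -78; 2063]; [:: 1; -80; 3771; -68031];
 [:: 1; -70; 2035]; [:: 1; -28; 1280; -36538; 474154]]%BZ.

Definition E8_row0 : seq (seq Z) := [::
 [:: 1; -343951];
 [:: 1; -617013; 114408765080];
 [:: 1; -798907; 282751667215; -35735806589924209];
 [:: 1; -856940; 425539016302; -104379436795829490; 9993839935017205599651];
 [:: 1; -729529; 432829460188; -151726960765414016; 28330217253272754577647;
     -2179416637633076321759567267];
 [:: 1; -688045; 266808978163; -35233552825657891];
 [:: 1; -576505; 114394278796];
 [:: 1; -785272; 405795576018; -100164907112706942; 9903754389256867421127];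
 [:: 1; -257021; 136948748040; -52648176428522086; 13411748464047431791309;
     -1981255267171584543842004205; 127328058210443378011141992840290]]%BZ.

Lemma zr_gt2 k : Z.ltb 2 k -> 2 < zr k.
Proof. by move=> k2; rewrite /zr -[2]/(2%:~R) ltr_int; lia. Qed.

(** The periods 2, 6 and 30 of the three types divide 6, 12 and 30, the least common multiples of
    the ranks (2,3,3), (2,3,4) and (2,3,5) of the exceptional tubes. *)
Lemma E6_torus_periodic y : frieze 7 E6tilde_arrows y -> torus_periodic 7 y.
Proof.
have check : table_check 7 E6tilde_arrows 7%BZ 2 [:: 1; 2; 1; 2; 1; 2; 3]%N E6_row0.
  by vm_compute.
move=> fy; exact (table_torus_periodic (N := 7) (s := E6tilde_arrows) (j3 := 7)
  isT check (@zr_gt2 7%BZ isT) fy erefl erefl erefl erefl isT isT isT erefl).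
Qed.

Lemma E7_torus_periodic y : frieze 8 E7tilde_arrows y -> torus_periodic 8 y.
Proof.
have check : table_check 8 E7tilde_arrows 61%BZ 6 [:: 1; 2; 3; 1; 2; 3; 2; 4]%N E7_row0.
  by vm_compute.
move=> fy; exact (table_torus_periodic (N := 8) (s := E7tilde_arrows) (j3 := 3)
  isT check (@zr_gt2 61%BZ isT) fy erefl erefl erefl erefl isT isT isT erefl).
Qed.

Lemma E8_torus_periodic y : frieze 9 E8tilde_arrows y -> torus_periodic 9 y.
Proof.
have check : table_check 9 E8tilde_arrows 403520%BZ 30 [:: 1; 2; 3; 4; 5; 3; 2; 4; 6]%N E8_row0.
  by vm_compute.
move=> fy; exact (table_torus_periodic (N := 9) (s := E8tilde_arrows) (j3 := 3)
  isT check (@zr_gt2 403520%BZ isT) fy erefl erefl erefl erefl isT isT isT erefl).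
Qed.

(** * Discrete Hill equations *)

Section Continuants.
Variable c : nat -> rat.

(* [cont j i] is the solution of [g (i+2) = c i * g (i+1) - g i] that starts with
   0, 1 at time [i], taken at time [i + j]. *)
Fixpoint cont (j i : nat) : rat :=
  match j with
  | 0 => 0
  | j'.+1 => if j' is j''.+1 then c (i + j'') * cont j' i - cont j'' i else 1
  end.

Lemma contSS j i : cont j.+2 i = c (i + j) * cont j.+1 i - cont j i.
Proof. by []. Qed.

Lemma contSS_left j i : cont j.+2 i = c i * cont j.+1 i.+1 - cont j i.+2.
Proof.
suff: cont j.+2 i = c i * cont j.+1 i.+1 - cont j i.+2 /\
  cont j.+3 i = c i * cont j.+2 i.+1 - cont j.+1 i.+2 by case.
elim: j => [|j [IH0 IH1]].
  by split; rewrite !contSS /= ?addn0 ?addn1; ring.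
split=> //; rewrite contSS IH1 IH0 !(contSS _ i.+1) !(contSS _ i.+2).
by rewrite !addnS !addSn; ring.
Qed.

(** These continuants are, up to sign, the entries of a product of transfer matrices of determinant
    1. *)
Lemma cont_det j i :
  cont j.+1 i * cont j.+1 i.+1 - cont j.+2 i * cont j i.+1 = 1.
Proof.
elim: j => [|j IH]; first by rewrite /=; ring.
by rewrite -[RHS]IH !(contSS _ i) (contSS _ i.+1) addSnnS; ring.
Qed.

Lemma cont_sol g i : (forall k, (i <= k)%N -> g k.+2 = c k * g k.+1 - g k) ->
  forall j, g (i + j).+1 = cont j.+1 i * g i.+1 - cont j i.+1 * g i.
Proof.
move=> Hg j; suff: g (i + j).+1 = cont j.+1 i * g i.+1 - cont j i.+1 * g i /\
  g (i + j).+2 = cont j.+2 i * g i.+1 - cont j.+1 i.+1 * g i by case.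
elim: j => [|j [IH0 IH1]].
  by rewrite addn0 Hg //=; split; rewrite ?addn0; ring.
split; rewrite addnS //.
rewrite Hg ?(leq_trans (leq_addr j i)) // (contSS j.+1 i) (contSS j i.+1) IH0 IH1 addnS addSn.
ring.
Qed.

(** Sturm's argument: the Wronskian of the continuant with the positive solution [g] is the positive
    constant [g i], so the continuant cannot return to zero. *)
Lemma cont_gt0 g i : (forall k, (i <= k)%N -> g k.+2 = c k * g k.+1 - g k) ->
  (forall k, (i <= k)%N -> 0 < g k) -> forall j, 0 < cont j.+1 i.
Proof.
move=> Hg g0; elim=> [//|j IH].
have E : cont j.+2 i * g (i + j)%N.+1 - cont j.+1 i * g (i + j)%N.+2 = g i.+1 * 0 + g i.
  elim: j {IH} => [|j IH]; first by rewrite addn0 (Hg i) //= addn0; ring.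
  rewrite addnS (contSS j.+1) (Hg (i + j).+1) ?leqW ?leq_addr // addnS.
  by rewrite -IH; ring.
have gj : 0 < g (i + j)%N.+1 by apply: g0; rewrite leqW ?leq_addr.
have gj2 : 0 < g (i + j)%N.+2 by apply: g0; rewrite !leqW ?leq_addr.
rewrite -(pmulr_lgt0 _ gj) -[X in 0 < X](subrK (cont j.+1 i * g (i + j)%N.+2)) E.
by rewrite mulr0 add0r addr_gt0 ?mulr_gt0 // g0.
Qed.

Section Periodic.
Variable q : nat.
Hypothesis c_per : forall i, c (i + q)%N = c i.

Lemma cont_period j i : cont j (i + q) = cont j i.
Proof.
suff: cont j (i + q) = cont j i /\ cont j.+1 (i + q) = cont j.+1 i by case.
by elim: j => [//|j [IH0 IH1]]; split=> //; rewrite !contSS IH0 IH1 addnAC c_per.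
Qed.

(** Trace of the matrix taking (g(i+1), g(i)) to (g(i+q+1), g(i+q)), as read off from [cont_sol]. *)
Definition cont_trace (i : nat) : rat := cont q.+1 i - cont q.-1 i.+1.

Lemma cont_traceE i : (0 < q)%N -> cont_trace i = cont_trace 0.
Proof.
move=> q0; elim: i => [//|i <-]; rewrite /cont_trace.
case: q c_per q0 => [//|n] per _ /=.
rewrite -/(cont n.+2 i.+1) -/(cont n.+2 i) contSS addSnnS per contSS_left; ring.
Qed.

(** Cayley-Hamilton for the monodromy matrix, which has determinant 1. *)
Lemma floquet g i : (0 < q)%N ->
  (forall k, (i <= k)%N -> g k.+2 = c k * g k.+1 - g k) ->
  g (i + q + q)%N = cont_trace 0 * g (i + q)%N - g i.
Proof.
move=> q0 Hg; rewrite -(cont_traceE i q0).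
have Hg' : forall k, (i + q <= k)%N -> g k.+2 = c k * g k.+1 - g k.
  by move=> k ik; apply: Hg; apply: leq_trans ik; apply: leq_addr.
move: (cont_sol Hg q) (cont_sol Hg q.-1) (cont_sol Hg' q.-1) (cont_det q.-1 i).
have P1 := cont_period q i; have P2 := cont_period q.-1 i.+1.
rewrite /cont_trace; case: q q0 P1 P2 {Hg'} => [//|n] _; rewrite !succnK => P1 P2.
rewrite -!addnS => E3 E2 E1 D.
by rewrite E1 P1 E3 -addSnnS P2 E2 -[X in _ = _ - X]mul1r -D; ring.
Qed.

End Periodic.
End Continuants.

Lemma path_arrows_rcons (l : seq nat) a b :
  path_arrows (rcons (rcons l a) b) = rcons (path_arrows (rcons l a)) (a, b).
Proof.
elim: l => [//|x l IH]; rewrite !rcons_cons.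
have E (s : seq nat) d : path_arrows (x :: rcons s d) = (x, head d s) :: path_arrows (rcons s d).
  by case: s.
by rewrite !E IH /=; congr ((_, _) :: _); case: (l).
Qed.

(** Because a b (K - 2) = (a c - b^2) + (a - b)^2. *)
Lemma trace_gt2 (K a b c : rat) : 0 < a -> 0 < b -> c = K * b - a -> b * b < a * c ->
  2 < K.
Proof.
move=> a0 b0 -> H; rewrite -subr_gt0 -(pmulr_rgt0 _ (mulr_gt0 a0 b0)).
have := sqr_ge0 (a - b); rewrite expr2 => S.
have -> : a * b * (K - 2) = (a * (K * b - a) - b * b) + (a - b) * (a - b) by ring.
by rewrite ltr_wpDr // subr_gt0.
Qed.

Lemma rev_iotaS a n : rev (iota a n.+1) = (a + n)%N :: rev (iota a n).
Proof. by rewrite -addn1 iotaD rev_cat. Qed.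

Lemma path_arrows_rev_iota a n :
  path_arrows (rev (iota a n.+2)) = (a + n.+1, a + n)%N :: path_arrows (rev (iota a n.+1)).
Proof. by rewrite !rev_iotaS. Qed.

Lemma prod_path_in (F : nat -> rat) a n l :
  \prod_(ab <- path_arrows (rev (iota a n.+1)) | ab.2 == l) F ab.1
  = if (a <= l < a + n)%N then F l.+1 else 1.
Proof.
elim: n => [|n IH]; first by rewrite big_nil addn0; case: ltnP => //; case: ltngtP.
rewrite path_arrows_rev_iota big_cons IH /= addnS.
have [<-|ne] := eqVneq (a + n)%N l; first by rewrite ltnn leq_addr ltnSn andbF mulr1.
by rewrite ltnS (leq_eqVlt l) [l == _]eq_sym (negbTE ne).
Qed.

Lemma prod_path_out (F : nat -> rat) a n l :
  \prod_(ab <- path_arrows (rev (iota a n.+1)) | ab.1 == l) F ab.2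
  = if (a < l <= a + n)%N then F l.-1 else 1.
Proof.
elim: n => [|n IH]; first by rewrite big_nil addn0; case: ltngtP.
rewrite path_arrows_rev_iota big_cons IH /= addnS.
have [<-|ne] := eqVneq (a + n).+1 l; first by rewrite ltnn leqnn ltnS leq_addr andbF mulr1.
by rewrite (leq_eqVlt l (a + n).+1) [l == _.+1]eq_sym (negbTE ne) ltnS.
Qed.

Lemma path_arrows_range a n N : (0 < a)%N -> (a + n <= N)%N ->
  all (fun ab => (0 < ab.2 < ab.1)%N && (ab.1 <= N)%N) (path_arrows (rev (iota a n.+1))).
Proof.
move=> a0; elim: n => [//|n IH] aN; rewrite path_arrows_rev_iota [all _ _]/= IH; last by lia.
by rewrite andbT; lia.
Qed.

(** * Type A *)

Section TypeA.
Variables (p q : nat) (y : nat -> nat -> rat).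
Hypotheses (p_gt0 : (0 < p)%N) (q_gt0 : (0 < q)%N).
Hypothesis fy : frieze (p + q) (Atilde_arrows p q) y.

Let N := (p + q)%N.

Lemma Atilde_arrowsE : Atilde_arrows p q =
  ((p + q)%N, q) :: path_arrows (rev (iota 1 q.-1.+1))
  ++ rcons (path_arrows (rev (iota q.+1 p.-1.+1))) (q.+1, 1%N).
Proof.
rewrite /Atilde_arrows -cat_cons; congr (_ ++ _).
  by case: q q_gt0 => // n _; rewrite rev_iotaS.
by case: p p_gt0 => // n _; rewrite [iota _ n.+1]/= rev_cons path_arrows_rcons.
Qed.

Lemma Atilde_arrows_range :
  all (fun ab => (0 < ab.2 < ab.1)%N && (ab.1 <= p + q)%N) (Atilde_arrows p q).
Proof.
rewrite Atilde_arrowsE -cats1 [all _ _]/= !all_cat !path_arrows_range //=; lia.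
Qed.

Lemma Atilde_prod_in (F : nat -> rat) l :
  \prod_(ab <- Atilde_arrows p q | ab.2 == l) F ab.1
  = (if q == l then F N else 1) * (if (1 <= l < q)%N then F l.+1 else 1)
    * ((if (q < l < N)%N then F l.+1 else 1) * (if 1%N == l then F q.+1 else 1)).
Proof.
rewrite Atilde_arrowsE big_cons big_cat -cats1 big_cat /= big_cons big_nil -/N !prod_path_in.
have -> : (1 + q.-1 = q)%N by rewrite add1n prednK.
have -> : (q.+1 + p.-1 = N)%N by rewrite /N; lia.
by case: (q == l); case: (1%N == l); rewrite ?mul1r ?mulr1 ?mulrA.
Qed.

Lemma Atilde_prod_out (F : nat -> rat) l :
  \prod_(ab <- Atilde_arrows p q | ab.1 == l) F ab.2
  = (if N == l then F q else 1) * (if (1 < l <= q)%N then F l.-1 else 1)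
    * ((if (q.+1 < l <= N)%N then F l.-1 else 1) * (if q.+1 == l then F 1%N else 1)).
Proof.
rewrite Atilde_arrowsE big_cons big_cat -cats1 big_cat /= big_cons big_nil -/N !prod_path_out.
have -> : (1 + q.-1 = q)%N by rewrite add1n prednK.
have -> : (q.+1 + p.-1 = N)%N by rewrite /N; lia.
by case: (N == l); case: (q.+1 == l); rewrite ?mul1r ?mulr1 ?mulrA.
Qed.

(** Values along the two paths, indexed by the distance from the sink 1; both ends are shared, the
    source [N] being reached at distance [q] and [p] respectively. *)
Let alpha (k t : nat) := y t (if k == q then N else k.+1).
Let beta (k t : nat) := y t (if k == 0%N then 1%N else q + k)%N.

Let alpha0 t : alpha 0 t = beta 0 t.
Proof. by rewrite /alpha /beta; case: eqP => // q0; move: q_gt0; rewrite -q0. Qed.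

Let alphaq t : alpha q t = beta p t.
Proof. by rewrite /alpha /beta eqxx /N addnC; case: eqP => // p0; move: p_gt0; rewrite p0. Qed.

Let alpha_rec k t : (0 < k < q)%N ->
  alpha k t * alpha k t.+1 = alpha k.+1 t * alpha k.-1 t.+1 + 1.
Proof.
move=> kq; have := friezeS fy t (l := k.+1); rewrite Atilde_prod_in Atilde_prod_out /alpha.
have -> : (0 < k.+1 <= p + q)%N by lia.
have -> : (q < k.+1 < N)%N = false by lia.
have -> : (1%N == k.+1) = false by lia.
have -> : (N == k.+1) = false by rewrite /N; lia.
have -> : (1 < k.+1 <= q)%N by lia.
have -> : (q.+1 < k.+1 <= N)%N = false by lia.
have -> : (q.+1 == k.+1) = false by lia.
have -> : (k == q) = false by lia.
have -> : (k.-1 == q) = false by lia.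
rewrite [k.+1.-1]/= prednK; last by case/andP: kq.
rewrite mulrC => ->//; rewrite !mulr1 mul1r eq_sym; case: eqVneq => kq'.
  by rewrite kq' ltnn andbF mulr1.
by (have -> : (0 < k.+1 < q)%N by lia); rewrite !mul1r.
Qed.

Let beta_rec k t : (0 < k < p)%N ->
  beta k t * beta k t.+1 = beta k.+1 t * beta k.-1 t.+1 + 1.
Proof.
move=> kp; have := friezeS fy t (l := (q + k)%N); rewrite Atilde_prod_in Atilde_prod_out /beta.
have -> : (0 < q + k <= p + q)%N by lia.
have -> : (q == q + k)%N = false by lia.
have -> : (0 < q + k < q)%N = false by lia.
have -> : (q < q + k < N)%N by rewrite /N; lia.
have -> : (1 == q + k)%N = false by lia.
have -> : (N == q + k)%N = false by rewrite /N; lia.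
have -> : (1 < q + k <= q)%N = false by lia.
have -> : (k == 0)%N = false by lia.
rewrite mulrC [k.+1 == 0%N]/= -addnS => ->//; rewrite !mul1r mulr1; congr (_ * _ + _).
have -> : (q.+1 == q + k)%N = (k.-1 == 0)%N by lia.
case: eqVneq => k1.
  by (have -> : (q.+1 < q + k <= N)%N = false by lia); rewrite !mul1r.
have -> : (q.+1 < q + k <= N)%N by rewrite /N; lia.
by rewrite mulr1; congr y; lia.
Qed.

Let sink_rec t : alpha 0 t * alpha 0 t.+1 = alpha 1 t * beta 1 t + 1.
Proof.
have := friezeS fy t (l := 1%N); rewrite Atilde_prod_in Atilde_prod_out alpha0 alpha0 /alpha /beta.
have -> : (0 < 1 <= p + q)%N by lia.
have -> : (q < 1 < N)%N = false by lia.
have -> : (N == 1)%N = false by rewrite /N; lia.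
have -> : (1 < 1 <= q)%N = false by lia.
have -> : (q.+1 < 1 <= N)%N = false by lia.
have -> : (q.+1 == 1)%N = false by lia.
rewrite mulrC [1%N == 0%N]/= addn1 => ->//; rewrite !mulr1 !mul1r eq_sym; case: eqVneq => q1.
  by rewrite -q1 /= mulr1.
by (have -> : (0 < 1 < q)%N by lia); rewrite !mul1r.
Qed.

Let source_rec t : alpha q t * alpha q t.+1 = alpha q.-1 t.+1 * beta p.-1 t.+1 + 1.
Proof.
have := friezeS fy t (l := N); rewrite Atilde_prod_in Atilde_prod_out /alpha /beta.
have -> : (0 < N <= p + q)%N by rewrite /N; lia.
have -> : (q == N)%N = false by rewrite /N; lia.
have -> : (0 < N < q)%N = false by rewrite /N; lia.
have -> : (q < N < N)%N = false by rewrite /N; lia.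
have -> : (1 == N)%N = false by rewrite /N; lia.
have -> : (1 < N <= q)%N = false by rewrite /N; lia.
have -> : (q.-1 == q)%N = false by lia.
rewrite mulrC !eqxx => ->//; rewrite !mulr1 !mul1r (prednK q_gt0); congr (_ * _ + _).
have -> : (q.+1 == N)%N = (p.-1 == 0)%N by rewrite /N; lia.
case: eqVneq => p1.
  by (have -> : (q.+1 < N <= N)%N = false by rewrite /N; lia); rewrite !mul1r.
have -> : (q.+1 < N <= N)%N by rewrite /N; lia.
by rewrite mulr1; congr y; rewrite /N; lia.
Qed.

(* The frieze unfolded on the universal cover of the quiver: an SL2-tiling of the
   half plane [j <= i + p], invariant under the translation by (q, -p). *)
Definition tiling (i j : nat) : rat :=
  let e := ((i + p - j) %/ N)%N in let r := ((i + p - j) %% N)%N in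
  if (r < p)%N then beta (p - r)%N (i - e * q)%N else alpha (r - p)%N (j + e * p)%N.

(** After [e] windings the point lies [k] steps along the first path. At [k = q] it has reached the
    source, which the definition stores as the end of the other path in the next winding. *)
Let tiling_alpha i j e k : i = (j + e * N + k)%N -> (k <= q)%N ->
  tiling i j = alpha k (j + e * p)%N.
Proof.
move=> -> kq; rewrite /tiling.
have -> : (j + e * N + k + p - j = e * N + (p + k))%N by lia.
have N0 : (0 < N)%N by rewrite /N; lia.
move: kq; rewrite leq_eqVlt => /orP [/eqP ->|kq].
  have -> : (e * N + (p + q) = e.+1 * N)%N by rewrite mulSn addnC.
  rewrite mulnK // modnMl p_gt0 subn0 alphaq; congr beta.
  by rewrite /N mulSn mulnDr; lia.
have kN : (p + k < N)%N by rewrite /N ltn_add2l.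
rewrite divnMDl // modnMDl divn_small // modn_small // addn0 ltnNge leq_addr /=.
by rewrite addnC addnK.
Qed.

Let tiling_beta i j e k : (i + k)%N = (j + e * N)%N -> (k <= p)%N -> (e * q <= i)%N ->
  tiling i j = beta k (i - e * q)%N.
Proof.
case: k => [|k] E kp ei.
  rewrite (@tiling_alpha i j e 0) ?alpha0 //; last by rewrite -E !addn0.
  by congr beta; move: E ei; rewrite /N mulnDr; lia.
rewrite /tiling.
have N0 : (0 < N)%N by rewrite /N; lia.
have -> : (i + p - j = e * N + (p - k.+1))%N by lia.
have kN : (p - k.+1 < N)%N by rewrite /N; lia.
rewrite divnMDl // modnMDl divn_small // modn_small // addn0.
have -> : (p - k.+1 < p)%N by lia.
by congr beta; lia.
Qed.

Let beta_gt0 k t : 0 < beta k t. Proof. exact: (frieze_gt0 fy). Qed.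
Let alpha_gt0 k t : 0 < alpha k t. Proof. exact: (frieze_gt0 fy). Qed.

Lemma tiling_gt0 i j : 0 < tiling i j.
Proof. by rewrite /tiling; case: ifP. Qed.

(** A diagonal step is one unit of time, and the off-diagonal neighbours are the adjacent vertices
    at the times prescribed by the orientation. The residues r = 0, 0 < r < p, r = p, r > p are the
    source, the inside of the second path, the sink and the inside of the first. *)
Lemma tiling_sl2 i j : (j < i + p)%N ->
  tiling i j * tiling i.+1 j.+1 = tiling i.+1 j * tiling i j.+1 + 1.
Proof.
move=> ji; pose e := ((i + p - j) %/ N)%N; pose r := ((i + p - j) %% N)%N.
have N0 : (0 < N)%N by rewrite /N; lia.
have rN : (r < N)%N by rewrite ltn_mod.
have D : (i + p = j + e * N + r)%N by rewrite -addnA -divn_eq; lia.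
have eN : (e * N = e * p + e * q)%N by rewrite mulnDr.
have [rp|pr|rp] := ltngtP r p.
- have [r0|r0] := posnP r.
    have e0 : (0 < e)%N by rewrite lt0n; apply/eqP => e0; move: D; rewrite e0 r0; lia.
    have e1N : (e.-1 * N + N = e * N)%N by rewrite -mulSnr prednK.
    have e1p : (e.-1 * p + p = e * p)%N by rewrite -mulSnr prednK.
    have ei : (e * q <= i)%N by lia.
    rewrite (@tiling_beta i j e p) //; last by rewrite D r0 addn0.
    rewrite (@tiling_beta i.+1 j.+1 e p) //; [|by rewrite addSn D r0 addn0|by lia].
    rewrite (@tiling_beta i.+1 j e p.-1) //; [|by lia|by lia|by lia].
    rewrite (@tiling_alpha i j.+1 e.-1 q.-1) //; [|by rewrite /N in e1N D; lia|by lia].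
    have -> : (j.+1 + e.-1 * p = (i - e * q).+1)%N by lia.
    by rewrite subSn // -!alphaq source_rec mulrC.
  have ei : (e * q <= i)%N.
    have [->//|e0] := posnP e.
    by have := leq_pmull p e0; lia.
  rewrite (@tiling_beta i j e (p - r)%N) //; [|by lia|by lia].
  rewrite (@tiling_beta i.+1 j.+1 e (p - r)%N) //; [|by lia|by lia|by lia].
  rewrite (@tiling_beta i.+1 j e (p - r).-1%N) //; [|by lia|by lia|by lia].
  rewrite (@tiling_beta i j.+1 e (p - r).+1%N) //; [|by lia|by lia].
  by rewrite subSn // beta_rec 1?mulrC //; lia.
- rewrite (@tiling_alpha i j e (r - p)%N) //; [|by lia|by rewrite /N in rN; lia].
  rewrite (@tiling_alpha i.+1 j.+1 e (r - p)%N) //; [|by lia|by rewrite /N in rN; lia].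
  rewrite (@tiling_alpha i.+1 j e (r - p).+1%N) //; [|by lia|by rewrite /N in rN; lia].
  rewrite (@tiling_alpha i j.+1 e (r - p).-1%N) //; [|by lia|by rewrite /N in rN; lia].
  by rewrite addSn alpha_rec //; rewrite /N in rN; lia.
- rewrite (@tiling_alpha i j e 0) //; last by lia.
  rewrite (@tiling_alpha i.+1 j.+1 e 0) //; last by lia.
  rewrite (@tiling_alpha i.+1 j e 1) //; last by lia.
  rewrite (@tiling_beta i j.+1 e 1) //; [|by lia|by lia].
  have -> : (i - e * q = j + e * p)%N by lia.
  by rewrite addSn sink_rec.
Qed.

Lemma tiling_per i j : (j <= i)%N -> tiling (i + q) j = tiling i (j + p).
Proof.
move=> ji; rewrite /tiling.
have N0 : (0 < N)%N by rewrite /N; lia.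
have -> : (i + q + p - j = i + p - (j + p) + N)%N by rewrite /N; lia.
rewrite divnDr // divnn N0 modnDr addn1.
case: ifP => _; first by congr beta; rewrite mulSn; lia.
by congr alpha; rewrite mulSn; lia.
Qed.

Lemma tiling_per_iter n i j : (j + n * p <= i + p)%N ->
  tiling (i + n * q) j = tiling i (j + n * p).
Proof.
elim: n i j => [|n IH] i j le_ij; first by rewrite !mul0n !addn0.
have [np nq] : (n * p <= n.+1 * p)%N /\ (n.+1 * q = n * q + q)%N.
  by rewrite leq_mul2r leqnSn orbT mulSnr.
have pS : (n.+1 * p = p + n * p)%N by rewrite mulSn.
rewrite nq addnA tiling_per; last by lia.
by rewrite IH; [rewrite pS addnA | rewrite -addnA -pS].
Qed.

Definition row_coef (i : nat) : rat := (tiling i 0 + tiling i.+2 0) / tiling i.+1 0.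

(** In an SL2-tiling the linear relation between three consecutive rows passes from one column to
    the next, so the coefficient found in column 0 serves all. *)
Lemma tiling_row j i : (j <= i + p)%N ->
  tiling i.+2 j = row_coef i * tiling i.+1 j - tiling i j.
Proof.
have f0 a b : tiling a b != 0 by rewrite gt_eqF // tiling_gt0.
elim: j => [_|j IH ji]; first by rewrite /row_coef divfK // addrAC subrr add0r.
have {}IH := IH (ltnW ji).
have E1 := tiling_sl2 ji; have E2 := @tiling_sl2 i.+1 j (ltnW ji).
have H : tiling i.+1 j * tiling i j.+1 = tiling i j * tiling i.+1 j.+1 - 1.
  by rewrite E1 addrK.
apply: (mulIf (f0 i.+1 j)); rewrite mulrC E2 IH [in RHS]mulrBl [X in _ = _ - X]mulrC H.
ring.
Qed.

(** Moving down [q] rows amounts to moving right [p] columns, and the row coefficient is the same in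
    every column. *)
Lemma row_coef_per i : row_coef (i + q) = row_coef i.
Proof.
have f0 a b : tiling a b != 0 by rewrite gt_eqF // tiling_gt0.
rewrite /row_coef -!addSn !tiling_per // add0n -/(row_coef _).
rewrite [X in (_ + X) / _]tiling_row ?leq_addl //.
by rewrite addrC subrK mulfK.
Qed.

(** Time pq is the translation by (pq, pq); adding [q] times the invariant translation (q, -p) turns
    it into (q(p+q), 0), a shift by [L] within one column. *)
Let L := (q * N)%N.

Lemma row_coef_perL i : row_coef (i + L) = row_coef i.
Proof.
rewrite /L mulnC; elim: N => [|n IH]; first by rewrite mul0n addn0.
by rewrite mulSnr addnA row_coef_per.
Qed.

Let K := cont_trace row_coef L 0.

Let L_gt0 : (0 < L)%N. Proof. by rewrite muln_gt0 q_gt0 /N addn_gt0 p_gt0. Qed.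

Lemma tiling_lucas i j : (j <= i + p)%N -> lucas K (fun s => tiling (i + s * L) j).
Proof.
move=> ji s; rewrite !mulSnr !addnA.
apply: (floquet row_coef_perL (g := fun i => tiling i j)) => // k ik.
by apply: tiling_row; lia.
Qed.

Let ratio i j := tiling i.+1 j / tiling i j.

Let ratioS i j : (j < i + p)%N -> ratio i j < ratio i j.+1.
Proof.
move=> ji; rewrite /ratio ltr_pdivrMr ?tiling_gt0 // mulrAC ltr_pdivlMr ?tiling_gt0 //.
by rewrite [X in _ < X]mulrC tiling_sl2 // ltrDl.
Qed.

Let ratio_add n i j : (0 < n)%N -> (j + n <= i + p)%N -> ratio i j < ratio i (j + n).
Proof.
case: n => // n _; elim: n => [|n IH] ji; first by rewrite addn1 ratioS // -addn1.
by apply: lt_trans (IH _) _; [lia | rewrite [(j + n.+2)%N]addnS ratioS //; lia].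
Qed.

Let ratio_perL i j : (j <= i)%N -> ratio i j < ratio (i + L) j.
Proof.
have q1 k : (j <= k)%N -> ratio k j < ratio (k + q) j.
  move=> jk; rewrite [X in _ < X]/ratio -addSn !tiling_per ?(leqW jk) // -/(ratio _ _).
  by rewrite ratio_add // leq_add2r.
move=> ji; rewrite /L mulnC; have : (0 < N)%N by rewrite /N addn_gt0 p_gt0.
elim: N => [//|[|n] IH] _; first by rewrite mul1n q1.
by apply: lt_trans (IH isT) _; rewrite [(n.+2 * q)%N]mulSnr addnA q1 //; lia.
Qed.

(** By the SL2 rule the ratio of consecutive rows grows with the column, hence by periodicity with
    the row after [L] steps. Rearranged, the growth over [L] rows increases, which gives
    log-convexity. *)
Let growth_lt i j k : (j <= i)%N -> (0 < k)%N ->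
  tiling (i + L) j / tiling i j < tiling (i + k + L) j / tiling (i + k) j.
Proof.
have step a : (j <= a)%N -> tiling (a + L) j / tiling a j < tiling (a.+1 + L) j / tiling a.+1 j.
  move=> /ratio_perL; rewrite /ratio addSn.
  rewrite !ltr_pdivrMr ?tiling_gt0 // ![_ / _ * _]mulrAC !ltr_pdivlMr ?tiling_gt0 //.
  by rewrite mulrC.
move=> ji; case: k => // k _; elim: k => [|k IH]; first by rewrite addn1 step.
by apply: lt_trans IH _; rewrite [(i + k.+2)%N]addnS step //; lia.
Qed.

Lemma typeA_trace_gt2 : 2 < K.
Proof.
have := @tiling_lucas 0 0 (leq0n _) 0; rewrite mul0n mul1n add0n mul2n -addnn !add0n.
have := @growth_lt 0 0 L (leqnn 0) L_gt0; rewrite !add0n.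
rewrite ltr_pdivrMr ?tiling_gt0 // mulrAC ltr_pdivlMr ?tiling_gt0 // => lt01 E.
apply: (trace_gt2 (tiling_gt0 0 0) (tiling_gt0 L 0) E).
by rewrite [X in _ < X]mulrC.
Qed.

Let tiling_time i j s : (j <= i + p)%N ->
  tiling (i + p * q * s) (j + p * q * s) = tiling (i + s * L) j.
Proof.
move=> ji; have -> : (j + p * q * s = j + q * s * p)%N by rewrite -mulnA mulnC.
rewrite -tiling_per_iter; first by congr tiling; rewrite /L /N; ring.
have -> : (q * s * p = p * q * s)%N by ring.
by lia.
Qed.

Let label_tiling l : (0 < l <= N)%N -> exists i j, (j <= i + p)%N /\
  forall t, y t l = tiling (i + t) (j + t).
Proof.
move=> /andP [l0 lN]; have [lq|ql] := leqP l q.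
  exists l.-1, 0%N; split=> // t.
  rewrite (@tiling_alpha _ _ 0 l.-1) ?mul0n ?addn0 //; [|by lia|by lia].
  by rewrite /alpha (_ : (l.-1 == q) = false) ?prednK //; lia.
exists 0%N, (l - q)%N; split=> [|t]; first by rewrite /N in lN; lia.
rewrite (@tiling_beta _ _ 0 (l - q)%N) ?mul0n ?subn0 ?add0n //; [|by lia|by rewrite /N in lN; lia].
rewrite /beta (_ : (l - q == 0)%N = false); last by lia.
by congr y; lia.
Qed.

Lemma typeA_torus_periodic : torus_periodic N y.
Proof.
have key i j l r : (j <= i + p)%N -> (forall t, y t l = tiling (i + t) (j + t)) ->
    (fun s => y (r + p * q * s)%N l) =1 (fun s => tiling (i + r + s * L) (j + r)).
  by move=> ji H s; rewrite H !addnA tiling_time //; lia.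
exists (p * q)%N, K; split=> [||r rm]; first by rewrite muln_gt0 p_gt0.
  exact: typeA_trace_gt2.
split=> [l /label_tiling [i [j [ji H]]]|].
  apply: seq_alg_ext (key i j l r ji H).
  by apply: seq_alg_gen; apply: tiling_lucas; lia.
(* The neighbour of the sink on the first path, which is the source when [q = 1]; with vertex 1 it
   supplies two consecutive rows of one column. *)
pose l1 := if 1%N == q then N else 2%N.
have y1 t : y t 1 = tiling (0 + t) (0 + t).
  by rewrite (@tiling_alpha _ _ 0 0) ?mul0n ?addn0 // alpha0.
have yl1 t : y t l1 = tiling (1 + t) (0 + t).
  by rewrite (@tiling_alpha _ _ 0 1) ?mul0n ?addn0 // add0n addnC.
have l1N : (0 < l1 <= N)%N by rewrite /l1 /N; case: eqP; lia.
have N1 : (0 < 1 <= N)%N by rewrite /N; lia.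
exists (fun s => tiling (0 + r + s * L) (0 + r)), (fun s => tiling (1 + r + s * L) (0 + r)).
split.
- by apply: tiling_lucas; lia.
- by apply: tiling_lucas; lia.
- rewrite !mul0n !mul1n !addn0 !add0n add1n subr_eq0 gt_eqF //.
  have := @ratio_perL r r (leqnn r).
  rewrite /ratio ltr_pdivrMr ?tiling_gt0 // mulrAC ltr_pdivlMr ?tiling_gt0 // addSn.
  by rewrite mulrC [X in _ < X]mulrC.
- move=> f [] ->; apply: seq_alg_gen; [exists 1%N|exists l1] => // s; apply/esym.
    exact: (key 0%N 0%N 1%N r (leq0n _) y1).
  exact: (key 1%N 0%N l1 r (leq0n _) yl1).
Qed.

End TypeA.

(** * Type D *)

Section TypeD.
Variables (n : nat) (y : nat -> nat -> rat).
Hypothesis n_ge5 : (5 <= n)%N.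
Hypothesis fy : frieze n (Dtilde_arrows n) y.

Lemma Dtilde_arrowsE : Dtilde_arrows n =
  [:: (3, 1); (3, 2)]%N ++ path_arrows (rev (iota 3 (n - 5).+1))
  ++ [:: (n, n - 2); (n - 1, n - 2)]%N.
Proof. by rewrite /Dtilde_arrows (_ : n - 4 = (n - 5).+1)%N //; lia. Qed.

Lemma Dtilde_arrows_range :
  all (fun ab => (0 < ab.2 < ab.1)%N && (ab.1 <= n)%N) (Dtilde_arrows n).
Proof. rewrite Dtilde_arrowsE !all_cat path_arrows_range //=; lia. Qed.

Lemma Dtilde_prod_in (F : nat -> rat) l :
  \prod_(ab <- Dtilde_arrows n | ab.2 == l) F ab.1
  = (if 1%N == l then F 3 else 1) * (if 2%N == l then F 3 else 1)
    * (if (3 <= l < n - 2)%N then F l.+1 else 1)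
    * (if (n - 2)%N == l then F n * F (n - 1)%N else 1).
Proof.
rewrite Dtilde_arrowsE.
rewrite !big_cat !big_cons !big_nil prod_path_in /= (_ : 3 + (n - 5) = n - 2)%N; last by lia.
by case: (1%N == l); case: (2%N == l); case: ((n - 2)%N == l); rewrite ?mulr1 ?mul1r ?mulrA.
Qed.

Lemma Dtilde_prod_out (F : nat -> rat) l :
  \prod_(ab <- Dtilde_arrows n | ab.1 == l) F ab.2
  = (if 3%N == l then F 1%N * F 2%N else 1)
    * (if (3 < l <= n - 2)%N then F l.-1 else 1)
    * (if n == l then F (n - 2)%N else 1) * (if (n - 1)%N == l then F (n - 2)%N else 1).
Proof.
rewrite Dtilde_arrowsE.
rewrite !big_cat !big_cons !big_nil prod_path_out /= (_ : 3 + (n - 5) = n - 2)%N; last by lia.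
by case: (3%N == l); case: (n == l); case: ((n - 1)%N == l); rewrite ?mulr1 ?mul1r ?mulrA.
Qed.

Let x t := y t 1%N.
Let u t := y t n.

Let y_gt0 t l : 0 < y t l. Proof. exact: (frieze_gt0 fy). Qed.
Let y_neq0 t l : y t l != 0. Proof. by rewrite gt_eqF. Qed.

Let y1S t l : l = 1%N \/ l = 2%N -> y t.+1 l * y t l = y t 3 + 1.
Proof.
move=> l12; have := friezeS fy t (l := l); rewrite Dtilde_prod_in Dtilde_prod_out.
have -> : (0 < l <= n)%N by case: l12 => ->; lia.
have -> : (3 <= l < n - 2)%N = false by case: l12 => ->; lia.
have -> : (n - 2 == l)%N = false by case: l12 => ->; lia.
have -> : (3 == l)%N = false by case: l12 => ->; lia.
have -> : (3 < l <= n - 2)%N = false by case: l12 => ->; lia.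
have -> : (n == l)%N = false by case: l12 => ->; lia.
have -> : (n - 1 == l)%N = false by case: l12 => ->; lia.
by move=> -> //; case: l12 => -> /=; rewrite !mulr1 ?mul1r.
Qed.

Let y2 t : y t 2 = x t.
Proof.
elim: t => [|t IH]; first by rewrite /x !(frieze0 fy).
apply: (mulIf (y_neq0 t 2)); rewrite (@y1S t 2); last by right.
by rewrite IH -(@y1S t 1) //; left.
Qed.

Let ynS t l : l = n \/ l = (n - 1)%N -> y t.+1 l * y t l = y t.+1 (n - 2)%N + 1.
Proof.
move=> ln; have := friezeS fy t (l := l); rewrite Dtilde_prod_in Dtilde_prod_out.
have -> : (0 < l <= n)%N by case: ln => ->; lia.
have -> : (1 == l)%N = false by case: ln => ->; lia.
have -> : (2 == l)%N = false by case: ln => ->; lia.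
have -> : (3 <= l < n - 2)%N = false by case: ln => ->; lia.
have -> : (n - 2 == l)%N = false by case: ln => ->; lia.
have -> : (3 == l)%N = false by case: ln => ->; lia.
have -> : (3 < l <= n - 2)%N = false by case: ln => ->; lia.
move=> -> //; case: ln => ->; rewrite eqxx !mul1r.
  by (have -> : (n - 1 == n)%N = false by lia); rewrite mulr1.
by (have -> : (n == n - 1)%N = false by lia); rewrite mul1r.
Qed.

Let yn1 t : y t (n - 1)%N = u t.
Proof.
elim: t => [|t IH]; first by rewrite /u !(frieze0 fy).
apply: (mulIf (y_neq0 t (n - 1)%N)); rewrite (@ynS t (n - 1)%N); last by right.
by rewrite IH -(@ynS t n) //; left.
Qed.

(* With the squares of the two ends put at both ends of the spine, the spine
   obeys the SL2 rule. *)
Let z k t := if k == 2%N then x t ^+ 2 else if k == n.-1 then u t ^+ 2 else y t k.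

Let zS k t : (2 < k < n.-1)%N -> z k t.+1 * z k t = z k.+1 t * z k.-1 t.+1 + 1.
Proof.
move=> kn; have := friezeS fy t (l := k); rewrite Dtilde_prod_in Dtilde_prod_out /z.
have -> : (0 < k <= n)%N by lia.
have -> : (k == 2)%N = false by lia.
have -> : (k == n.-1)%N = false by lia.
have -> : (k.-1 == n.-1)%N = false by lia.
have -> : (k.+1 == 2)%N = false by lia.
have -> : (1 == k)%N = false by lia.
have -> : (2 == k)%N = false by lia.
have -> : (n == k)%N = false by lia.
have -> : (n - 1 == k)%N = false by lia.
have -> : (k.-1 == 2)%N = (3 == k)%N by lia.
have -> : (n - 2 == k)%N = (k.+1 == n.-1)%N by lia.
move=> -> //; rewrite !mul1r !mulr1 yn1 y2; congr (_ * _ + _).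
  case: eqVneq => kn1; first by (have -> : (2 < k < n - 2)%N = false by lia); rewrite mul1r expr2.
  by (have -> : (2 < k < n - 2)%N by lia); rewrite mulr1.
case: eqVneq => k3; first by (have -> : (3 < k <= n - 2)%N = false by lia); rewrite mulr1 expr2.
by (have -> : (3 < k <= n - 2)%N by lia); rewrite mul1r.
Qed.

Let z_gt0 k t : 0 < z k t.
Proof. by rewrite /z; case: ifP => _; [|case: ifP => _]; rewrite ?exprn_gt0 ?y_gt0. Qed.

Definition spine_coef t := (x t + x t.+2) / x t.+1.

Let x_sol t : x t.+2 = spine_coef t * x t.+1 - x t.
Proof. by rewrite /spine_coef divfK ?y_neq0 // addrAC subrr add0r. Qed.

(** The candidate for the spine: it starts with x_t^2 and x_t x_(t+1) - 1, and obeys the same SL2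
    rule as [z]. *)
Let g t j := x t * x (t + j)%N - cont spine_coef j t.

Let g_right t j : g t j.+2 = spine_coef (t + j) * g t j.+1 - g t j.
Proof. by rewrite /g contSS !addnS x_sol; ring. Qed.

Let g_left t j : g t j.+2 = spine_coef t * g t.+1 j.+1 - g t.+2 j.
Proof.
rewrite /g contSS_left !addSn !addnS.
have -> : x t = spine_coef t * x t.+1 - x t.+2 by rewrite x_sol; ring.
by ring.
Qed.

Let x_cont t j : x (t + j).+1 = cont spine_coef j.+1 t * x t.+1 - cont spine_coef j t.+1 * x t.
Proof. by apply: (cont_sol (g := x)) => k _; apply: x_sol. Qed.

Let g_plucker t j : g t j.+1 * g t.+1 j.+1 = g t j.+2 * g t.+1 j + 1.
Proof.
have D := cont_det spine_coef j t.
have E1 := x_cont t j; have E2 := x_cont t j.+1; rewrite addnS in E2.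
rewrite /g !addSn !addnS E1 E2 -D.
by move: (cont _ _ _) (cont _ _ _) (cont _ _ _) (cont _ _ _) => *; ring.
Qed.

Let m := (n - 3)%N.

Let z_g j t : (j <= m)%N -> z j.+2 t = g t j.
Proof.
suff: (j <= m)%N -> (forall t, z j.+2 t = g t j) /\ (j.+1 <= m -> forall t, z j.+3 t = g t j.+1)%N.
  by move=> H /H [].
elim: j {t} => [|j IH] jm.
  split=> [t|_ t]; first by rewrite /z /g eqxx addn0 subr0.
  rewrite /z /g /= (_ : (3 == n.-1)%N = false); last by lia.
  by rewrite addn1 -[x t.+1]mulr1 [1]/(cont spine_coef 1 t) mulr1 mulrC (@y1S t 1) ?addrK //; left.
have [IH0 IH1] := IH (ltnW jm); split=> [t|jm' t]; first exact: IH1.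
have zn0 : z j.+2 t.+1 != 0 by rewrite gt_eqF.
have zz := @zS j.+3 t; rewrite succnK in zz.
apply: (mulIf zn0); apply: (addIr 1).
rewrite -zz; last by rewrite /m in jm'; lia.
by rewrite !IH1 // IH0 mulrC g_plucker.
Qed.

Let m_gt1 : (1 < m)%N. Proof. by rewrite /m; lia. Qed.
Let m1 : m.-1.+1 = m. Proof. by rewrite prednK // ltnW. Qed.

Let u2_g t : u t ^+ 2 = g t m.
Proof.
rewrite -z_g // /z (_ : m.+2 = n.-1) ?eqxx; last by rewrite /m; lia.
by rewrite (_ : (n.-1 == 2)%N = false) //; lia.
Qed.

Let uu_g t : u t * u t.+1 = g t.+1 m.-1 + 1.
Proof.
rewrite mulrC /u (@ynS t n); last by left.
rewrite -z_g ?leq_pred // /z (_ : m.-1.+2 = n - 2)%N; last by rewrite /m; lia.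
by rewrite !ifF //; lia.
Qed.

(** The far end reflects the pattern: squaring u_t u_(t+1) gives (g' + 1)^2 with g' = [g t.+1 m.-1],
    while the product of the squares is g' times [g t m.+1] plus 1; cancel g'. *)
Let g_turn t : g t m.+1 = g t.+1 m.-1 + 2.
Proof.
have g0 : g t.+1 m.-1 != 0 by rewrite -z_g ?leq_pred // gt_eqF.
have P := g_plucker t m.-1; rewrite m1 in P.
have := congr1 (fun a => a ^+ 2) (uu_g t); rewrite exprMn !u2_g P => E.
apply: (mulIf g0); apply: (addIr 1); rewrite E; ring.
Qed.

Let spine_turn t : spine_coef t * g t.+1 m = g t.+2 m.-1 + g t.+1 m.-1 + 2.
Proof.
by have := g_left t m.-1; rewrite m1 g_turn => H; rewrite -addrA H; ring.
Qed.

(** Extending [g] past the far end from the left and from the right gives the same value, so the two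
    coefficients used agree. *)
Lemma spine_coef_per t : spine_coef (t + m) = spine_coef t.
Proof.
have gm : g t.+1 m != 0 by rewrite -u2_g expf_neq0 ?y_neq0.
apply: (mulIf gm); rewrite spine_turn.
have := g_right t.+1 m.-1; rewrite m1 g_turn.
have -> : (t.+1 + m.-1 = t + m)%N by rewrite addSnnS m1.
by move=> H; rewrite -addrA [_ + 2]addrC addrA H; ring.
Qed.

(** After multiplication by u_(t+1) every term is a value of [g], and the claim becomes
    [spine_turn]. *)
Let u_sol t : u t.+2 = spine_coef t * u t.+1 - u t.
Proof.
apply: (mulIf (y_neq0 t.+1 n)); rewrite -/(u _) mulrC uu_g mulrBl uu_g -mulrA -expr2 u2_g.
by rewrite spine_turn; ring.
Qed.

Let K := cont_trace spine_coef m 0.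

Let m_gt0 : (0 < m)%N. Proof. exact: ltnW. Qed.

Let sol_lucas f r : (forall t, f t.+2 = spine_coef t * f t.+1 - f t) ->
  lucas K (fun s => f (r + m * s)%N).
Proof.
move=> Hf s; rewrite !mulnSr !addnA.
by apply: (floquet spine_coef_per (g := f)).
Qed.

(** Unfolding [g] in [g_turn] gives x_t x_(t+m+1) - x_(t+1) x_(t+m) = K + 2. Positivity of [x] gives
    K > 0, so x_(t+m) / x_t increases with t. *)
Lemma typeD_trace_gt2 : 2 < K.
Proof.
have Lx := sol_lucas 0 x_sol 0; rewrite muln0 muln1 !add0n muln2 -addnn in Lx.
have K0 : 0 < K.
  rewrite -(pmulr_lgt0 _ (y_gt0 m 1)) -/(x m).
  by rewrite -[X in 0 < X](subrK (x 0)) -Lx addr_gt0 ?y_gt0.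
have step t : x t.+1 * x (t + m)%N < x t * x (t.+1 + m)%N.
  rewrite -subr_gt0 (_ : _ - _ = K + 2); first exact: (addr_gt0 K0 (ltr0n _ 2)).
  have -> : K = cont_trace spine_coef m t by rewrite (cont_traceE spine_coef_per).
  rewrite /cont_trace.
  have E : (t.+1 + m.-1 = t + m)%N by rewrite addSnnS m1.
  have := g_turn t; rewrite /g addnS E [(t.+1 + m)%N]addSn => H.
  by rewrite -[x t * _](subrK (cont spine_coef m.+1 t)) H; ring.
apply: (trace_gt2 (y_gt0 0 1) (y_gt0 m 1) Lx).
have lt_ratio k : (0 < k)%N -> x m / x 0%N < x (k + m)%N / x k.
  have st t : x (t + m)%N / x t < x (t.+1 + m)%N / x t.+1.
    rewrite ltr_pdivrMr ?y_gt0 // mulrAC ltr_pdivlMr ?y_gt0 // mulrC [X in _ < X]mulrC.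
    exact: step.
  case: k => // k _; elim: k => [|k IH]; first exact: (st 0%N).
  exact: lt_trans IH (st _).
have := lt_ratio m m_gt0.
by rewrite ltr_pdivrMr ?y_gt0 // mulrAC ltr_pdivlMr ?y_gt0 // [X in _ < X]mulrC.
Qed.

(** Constant in t, with initial value u_1 - x_1 = y_(1,n-2) - y_(0,3), where y_(0,3) = 1. *)
Let wronskian t : 0 < x t * u t.+1 - u t * x t.+1.
Proof.
elim: t => [|t IH]; last first.
  rewrite u_sol x_sol; apply: (lt_le_trans IH); rewrite le_eqVlt; apply/orP; left; apply/eqP.
  by ring.
rewrite /x /u !(frieze0 fy) !mul1r subr_gt0.
have := @y1S 0 1 (or_introl erefl); rewrite !(frieze0 fy) mulr1 => ->.
have := @ynS 0 n (or_introl erefl); rewrite !(frieze0 fy) mulr1 => ->.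
rewrite ltrD2r.
have k2 : (2 < n - 2 < n.-1)%N by lia.
have := zS 0 k2; rewrite ![z (n - 2)%N _]/z !ifF; try by lia.
by rewrite !(frieze0 fy) mulr1 => ->; rewrite ltrDr mulr_gt0.
Qed.

(** Over [m] steps the determinant is the Wronskian times a continuant, which is positive because
    [x] is a positive solution. *)
Let independent t : 0 < x t * u (t + m)%N - u t * x (t + m)%N.
Proof.
have c0 := cont_gt0 (g := x) (i := t) (c := spine_coef) (fun k _ => x_sol k)
  (fun k _ => y_gt0 k 1) m.-1.
have E := x_cont t m.-1.
have E' : u (t + m.-1).+1 = cont spine_coef m.-1.+1 t * u t.+1 - cont spine_coef m.-1 t.+1 * u t.
  by apply: (cont_sol (g := u)) => k _; apply: u_sol.
rewrite -addnS m1 in E E' c0; rewrite E E'.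
have := mulr_gt0 c0 (wronskian t); congr (0 < _); ring.
Qed.

Lemma typeD_torus_periodic : torus_periodic n y.
Proof.
have genK f r : (forall t, f t.+2 = spine_coef t * f t.+1 - f t) ->
    seq_alg (lucas K) (fun s => f (r + m * s)%N).
  by move=> Hf; apply: seq_alg_gen; apply: sol_lucas.
exists m, K; split=> [//||r rm]; first exact: typeD_trace_gt2.
split=> [l ln|].
  have [->|l1] := eqVneq l 1%N; first exact: (genK x r x_sol).
  have [->|l2] := eqVneq l 2%N.
    by apply: seq_alg_ext (genK x r x_sol) _ => s; rewrite y2.
  have [->|lnn] := eqVneq l n; first exact: (genK u r u_sol).
  have [->|ln1] := eqVneq l (n - 1)%N.
    by apply: seq_alg_ext (genK u r u_sol) _ => s; rewrite yn1.
  (* Periodicity freezes the continuant on a residue class, so a spine coordinate is a product of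
     two recurrent sequences minus a constant. *)
  have c_const j s : cont spine_coef j (r + m * s) = cont spine_coef j r.
    elim: s => [|s IH]; first by rewrite muln0 addn0.
    by rewrite mulnSr addnA (cont_period spine_coef_per).
  apply: seq_alg_ext (seq_algB (seq_algM (genK x r x_sol) (genK x (r + (l - 2))%N x_sol))
    (seq_alg_cst _ (cont spine_coef (l - 2) r))) _ => s.
  have := @z_g (l - 2) (r + m * s); rewrite /z /g (_ : (l - 2).+2 = l)%N; last by lia.
  rewrite !ifF; [|by lia|by lia].
  by rewrite /m => ->; [rewrite -/m c_const addnAC | lia].
exists (fun s => x (r + m * s)%N), (fun s => u (r + m * s)%N); split.
- exact: sol_lucas x_sol.
- exact: sol_lucas u_sol.
- rewrite !muln0 !muln1 !addn0; apply: lt0r_neq0.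
  by have := independent r; rewrite [u r * _]mulrC.
- move=> f [] ->; apply: seq_alg_gen; [exists 1%N|exists n] => //; lia.
Qed.

End TypeD.

Theorem theorem1p2 (R : realType) (N : nat) (Q : quiver N)
    (hQ : affine_quiver Q)
    (fc : {rmorphism ambient N -> ambient N})
    (hfc : coxeter_automorphism Q fc)
    (Y : set 'rV[R[i]]_N)
    (hY : irreducible_component
            (frieze_variety fc (const_mx 1 : 'rV[R[i]]_N)) Y) :
  smooth_variety Y.
Proof.
case: hQ fc hfc Y hY => {N Q} [p q p0 q0|n n5|||] fc hfc Y hY.
- apply: (torus_periodic_component_smooth _ _ hfc hY); last first.
    by move=> y; apply: typeA_torus_periodic.
  exact: Atilde_arrows_range.
- apply: (torus_periodic_component_smooth _ _ hfc hY); last first.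
    by move=> y; apply: typeD_torus_periodic.
  exact: Dtilde_arrows_range.
- by apply: (torus_periodic_component_smooth _ E6_torus_periodic hfc hY).
- by apply: (torus_periodic_component_smooth _ E7_torus_periodic hfc hY).
- by apply: (torus_periodic_component_smooth _ E8_torus_periodic hfc hY).
Qed.
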